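(* Let $C$ be a simple closed contour with bounded interior $\mathcal{D}^+$ and exterior $\mathcal{D}^-$, let $n\ge 0$ be an integer, let $f$ be a generalized Cauchy function of order $n$ with respect to $C$, and let $F$ be a complement function of order $n$ with respect to $C$. Then $$\oint_C J_n[f(z)]\,dz=\oint_C f^{(n)}(z)\,dz=0,\qquad \oint_C J_n^-[F(z)]\,dz=\oint_C F^{(n)}(z)\,dz=0.$$
   Context: $C$ is a simple closed regular (smooth) curve in the complex plane, traversed counterclockwise; $\mathcal{D}^+$ is the simply connected open domain bounded by $C$, and $\mathcal{D}^-$ is the open domain outside $C$. A generalized Cauchy function of order $n$ with respect to $C$ is a single-valued holomorphic function that is $n$ times continuously (complex) differentiable in $\mathcal{D}^+$ and in a neighborhood of $C$. A complement function of order $n$ with respect to $C$ is a single-valued holomorphic function $F$ that is $n$ times continuously (complex) differentiable in $\mathcal{D}^-$ and in a neighborhood of $C$, with $F(z)=O(|z|^{-m})$ for some $m\ge2$ as $|z|\to\infty$. Put $$J_n[f(z)]=\frac{1}{2\pi i}\oint_C\frac{f^{(n)}(t)}{t-z}\,dt,\qquad J_n^-[F(z)]=\frac{-1}{2\pi i}\oint_C\frac{F^{(n)}(t)}{t-z}\,dt\qquad(z\notin C).$$ For $z\in C$, $J_n[f(z)]$ means the limit of $J_n[f(z_+)]$ as $z_+\in\mathcal{D}^+$ tends to $z$, and $J_n^-[F(z)]$ means the limit of $J_n^-[F(z_-)]$ as $z_-\in\mathcal{D}^-$ tends to $z$. $f^{(0)}=f$ and $F^{(0)}=F$. *)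

(* Defs.v *)
(* Stdlib reals with Coquelicot; the complex plane is Coquelicot's [C]. *)
From Stdlib Require Import Reals ClassicalEpsilon.
From Coquelicot Require Import Coquelicot.

Open Scope R_scope.

(* Coquelicot equips [C] with several convertible structures.  Throughout,
   [C_UniformSpace] carries the topology, [C_NormedModule] (over [C_AbsRing])
   complex differentiation, and [C_R_CompleteNormedModule] (over [R_AbsRing])
   differentiation and integration of C-valued functions of a real variable. *)

(* A closed curve is a periodic map; one period is one traversal.
   Regular (smooth) means C^1 with nowhere vanishing velocity, also at the
   closing point, which periodicity makes a point like any other. *)
Record simple_closed_curve : Type := SimpleClosedCurve {
  gamma :> R -> C;
  dgamma : R -> C;
  period : R;
  period_pos : 0 < period;
  gamma_periodic : forall t : R, gamma (t + period) = gamma t;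
  gamma_simple : forall s t : R,
    0 <= s < period -> 0 <= t < period -> gamma s = gamma t -> s = t;
  gamma_deriv : forall t : R,
    @is_derive R_AbsRing C_R_NormedModule gamma t (dgamma t);
  dgamma_cont : forall t : R,
    @continuous R_UniformSpace C_UniformSpace dgamma t;
  dgamma_neq0 : forall t : R, dgamma t <> RtoC 0
}.

Definition on_curve (G : simple_closed_curve) (z : C) : Prop :=
  exists t : R, gamma G t = z.

Definition off_curve (G : simple_closed_curve) (z : C) : Prop :=
  ~ on_curve G z.

Definition open_C (U : C -> Prop) : Prop := @open C_UniformSpace U.

Definition connected_C (A : C -> Prop) : Prop :=
  forall U V : C -> Prop, open_C U -> open_C V ->
    (forall z, A z -> U z \/ V z) ->
    (exists z, A z /\ U z) -> (exists z, A z /\ V z) ->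
    exists z, A z /\ U z /\ V z.

Definition component (A : C -> Prop) (z w : C) : Prop :=
  exists S : C -> Prop,
    connected_C S /\ (forall u, S u -> A u) /\ S z /\ S w.

Definition bounded_C (A : C -> Prop) : Prop :=
  exists M : R, forall z, A z -> Cmod z <= M.

(* The domains D^+ and D^-: by the Jordan curve theorem the complement of the
   curve has one bounded and one unbounded connected component. *)
Definition D_plus (G : simple_closed_curve) (z : C) : Prop :=
  off_curve G z /\ bounded_C (component (off_curve G) z).

Definition D_minus (G : simple_closed_curve) (z : C) : Prop :=
  off_curve G z /\ ~ bounded_C (component (off_curve G) z).

Definition contour_integrand (G : simple_closed_curve) (g : C -> C) (t : R) : C :=
  (g (gamma G t) * dgamma G t)%C.

Definition contour_integrable (G : simple_closed_curve) (g : C -> C) : Prop :=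
  @ex_RInt C_R_NormedModule (contour_integrand G g) 0 (period G).

Definition contour_integral (G : simple_closed_curve) (g : C -> C) : C :=
  @RInt C_R_CompleteNormedModule (contour_integrand G g) 0 (period G).

Definition two_pi_i : C := (RtoC (2 * PI) * Ci)%C.

Definition winding_number (G : simple_closed_curve) (z : C) : C :=
  (/ two_pi_i * contour_integral G (fun t => / (t - z)))%C.

Definition counterclockwise (G : simple_closed_curve) : Prop :=
  forall z : C, D_plus G z -> winding_number G z = RtoC 1.

(* The n-th complex derivative f^(n). *)
Definition C_derive_n (n : nat) (f : C -> C) : C -> C :=
  Nat.iter n C_derive f.

Definition holomorphic_on (U : C -> Prop) (f : C -> C) : Prop :=
  forall z : C, U z -> @ex_derive C_AbsRing C_NormedModule f z.

Definition n_times_cont_diff_on (U : C -> Prop) (n : nat) (f : C -> C) : Prop :=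
  (forall k : nat, (k < n)%nat -> holomorphic_on U (C_derive_n k f)) /\
  (forall z : C, U z ->
     @continuous C_UniformSpace C_UniformSpace (C_derive_n n f) z).

Definition generalized_cauchy_function
    (G : simple_closed_curve) (n : nat) (f : C -> C) : Prop :=
  exists U : C -> Prop,
    open_C U /\ (forall z, D_plus G z -> U z) /\ (forall z, on_curve G z -> U z) /\
    holomorphic_on U f /\ n_times_cont_diff_on U n f.

Definition complement_function
    (G : simple_closed_curve) (n : nat) (F : C -> C) : Prop :=
  (exists U : C -> Prop,
    open_C U /\ (forall z, D_minus G z -> U z) /\ (forall z, on_curve G z -> U z) /\
    holomorphic_on U F /\ n_times_cont_diff_on U n F) /\
  (exists m : nat, (2 <= m)%nat /\
    exists M r : R, forall z : C, r < Cmod z -> Cmod (F z) <= M / Cmod z ^ m).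

Definition Jint (G : simple_closed_curve) (n : nat) (f : C -> C) (z : C) : C :=
  (/ two_pi_i * contour_integral G (fun t => C_derive_n n f t / (t - z)))%C.

Definition Jint_minus (G : simple_closed_curve) (n : nat) (F : C -> C) (z : C) : C :=
  (- / two_pi_i * contour_integral G (fun t => C_derive_n n F t / (t - z)))%C.

Definition is_lim_within (D : C -> Prop) (g : C -> C) (z l : C) : Prop :=
  filterlim g (within D (@locally C_UniformSpace z)) (@locally C_UniformSpace l).

(* [iota P] is the element satisfying [P] when there is exactly one. *)
Definition lim_within (D : C -> Prop) (g : C -> C) (z : C) : C :=
  @iota C_R_CompleteNormedModule (is_lim_within D g z).

Definition Jn (G : simple_closed_curve) (n : nat) (f : C -> C) (z : C) : C :=
  if excluded_middle_informative (on_curve G z)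
  then lim_within (D_plus G) (Jint G n f) z
  else Jint G n f z.

Definition Jn_minus (G : simple_closed_curve) (n : nat) (F : C -> C) (z : C) : C :=
  if excluded_middle_informative (on_curve G z)
  then lim_within (D_minus G) (Jint_minus G n F) z
  else Jint_minus G n F z.

(* Main.v *)
Require Import Defs.
From Stdlib Require Import Reals ZArith Lra Lia Classical ClassicalEpsilon.
From Coquelicot Require Import Coquelicot.

(** Let [g] be the [n]-th derivative of [f] or of [F].  Derivatives of
    holomorphic functions are holomorphic ([holomorphic_derivative]), so [g] is
    holomorphic on an open set [U] that contains the curve and one of the two
    domains.  Off [U] the winding number has a constant value [kappa]: it is
    zero on [D_minus] ([winding_D_minus]), which gives 0 for [f], and one on
    [D_plus] by the orientation, which gives 1 for [F].  Everything follows from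
    Cauchy's formula ([cauchy_integral_formula])

      [oint g(w) / (w - z) dw = 2 pi i (winding_number z - kappa) g(z)]

    for [z] off the curve.  Inside [D_plus], resp. [D_minus], it says that the
    Cauchy transform of [g] is [g] itself.  As [g] is continuous on the curve,
    the boundary values of the transform are those of [g].  As [z] tends to
    infinity, the left side times [z] tends to minus the contour integral of
    [g], and the right side times [z] tends to zero: the winding number is zero
    far away, and [z * g z] tends to zero in the case of [F]
    ([vanishing_derive]).  So the contour integral is zero
    ([contour_integral_zero]).

    The formula is proved by Dixon's method.  The function that is
    [oint (g(w) - g(z)) / (w - z) dw + 2 pi i kappa g(z)] on [U] and
    [oint g(w) / (w - z) dw] off [U] is well defined and entire
    ([dixon_entire]), and it vanishes at infinity for the same reasons; by
    Liouville's theorem ([entire_vanishing]) it is zero.  The local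
    theory behind this is Goursat's lemma ([goursat]), which gives primitives on
    balls, and Cauchy's formula on circles for functions with a continuous
    derivative ([cauchy_formula]), hence for these primitives.

    The boundary values are limits of Cauchy transforms, so they are determined
    only if [D_plus] and [D_minus] come close to every point of the curve.  This
    part of the Jordan curve theorem is obtained from the winding number: it
    takes different values on the two sides of the curve ([winding_jump]),
    while it is constant on each of the two domains ([domains_adherent]). *)

(** The topology of [C] given by the modulus, in which Coquelicot's rules for
    continuity of sums and products are stated. *)
Local Notation CU := (AbsRing_UniformSpace C_AbsRing).

(** * Complex differentiation, paths and their integrals *)

(** The epsilon-delta form of complex differentiability, free of the several
    structures that [C] carries. *)
Definition holo_deriv (f : C -> C) (z l : C) : Prop :=
  forall eps : R, 0 < eps -> exists delta : R, 0 < delta /\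
    forall w, Cmod (w - z) < delta ->
      Cmod (f w - f z - l * (w - z)) <= eps * Cmod (w - z).

(** The topology of [C] as a product and the one given by its modulus have the
    same open sets. *)
Lemma continuous_CU_codomain (T : UniformSpace) (f : T -> C) (x : T) :
  @continuous T C_UniformSpace f x <-> @continuous T CU f x.
Proof.
  split; intros H P HP; apply (H P); [apply <- locally_C | apply -> locally_C]; exact HP.
Qed.

Lemma continuous_CU_domain (V : UniformSpace) (f : C -> V) (z : C) :
  @continuous C_UniformSpace V f z <-> @continuous CU V f z.
Proof.
  split; intros H P HP; unfold filtermap; [apply -> locally_C | apply <- locally_C]; exact (H P HP).
Qed.

Lemma is_derive_holo_deriv (f : C -> C) (z l : C) :
  @is_derive C_AbsRing C_NormedModule f z l <-> holo_deriv f z l.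
Proof.
  split.
  - intros [_ H] eps Heps.
    destruct (H z (fun P HP => HP) (mkposreal eps Heps)) as [d Hd].
    exists d; split; [apply cond_pos|]. intros w Hw.
    specialize (Hd w Hw).
    change (Cmod (f w - f z - (w - z) * l) <= eps * Cmod (w - z)) in Hd.
    rewrite (Cmult_comm l). exact Hd.
  - intros H; split; [apply is_linear_scal_l|].
    intros x Hx eps.
    assert (x = z) as ->.
    { symmetry. exact (is_filter_lim_locally_unique (V := AbsRing_NormedModule C_AbsRing) z x Hx). }
    destruct (H eps (cond_pos eps)) as [d [Hd H1]].
    exists (mkposreal d Hd). intros w Hw.
    change (Cmod (f w - f z - (w - z) * l) <= eps * Cmod (w - z)).
    rewrite (Cmult_comm _ l). apply H1. exact Hw.
Qed.

Lemma norm_C_R (x : C) : @norm R_AbsRing C_R_NormedModule x = Cmod x.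
Proof.
  unfold norm; simpl. unfold prod_norm, Cmod. f_equal.
  change (Rabs (fst x) ^2 + Rabs (snd x)^2 = fst x ^2 + snd x ^ 2).
  now rewrite !pow2_abs.
Qed.

Lemma is_derive_path_iff (g : R -> C) (t : R) (v : C) :
  @is_derive R_AbsRing C_R_NormedModule g t v <->
  (forall eps, 0 < eps -> exists delta, 0 < delta /\
     forall s, Rabs (s - t) < delta ->
       Cmod (g s - g t - v * RtoC (s - t)) <= eps * Rabs (s - t)).
Proof.
  split.
  - intros [_ H] eps Heps.
    destruct (H t (fun P HP => HP) (mkposreal eps Heps)) as [d Hd].
    exists d; split; [apply cond_pos|]. intros s Hs.
    specialize (Hd s Hs). rewrite norm_C_R, scal_R_Cmult in Hd.
    rewrite (Cmult_comm v). exact Hd.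
  - intros H; split; [apply (@is_linear_scal_l R_AbsRing C_R_NormedModule)|].
    intros x Hx eps.
    assert (x = t) as ->.
    { symmetry. exact (is_filter_lim_locally_unique (V := R_NormedModule) t x Hx). }
    destruct (H eps (cond_pos eps)) as [d [Hd H1]].
    exists (mkposreal d Hd). intros s Hs.
    rewrite norm_C_R, scal_R_Cmult.
    specialize (H1 s Hs). rewrite (Cmult_comm v) in H1. exact H1.
Qed.

Lemma continuous_C_iff (f : C -> C) (z : C) :
  @continuous CU CU f z <->
  (forall eps, 0 < eps -> exists delta, 0 < delta /\
     forall w, Cmod (w - z) < delta -> Cmod (f w - f z) < eps).
Proof.
  split.
  - intros H eps Heps.
    destruct (proj1 (filterlim_locally (U := CU) f (f z)) H (mkposreal eps Heps)) as [d Hd].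
    exists d; split; [apply cond_pos|]. intros w Hw. exact (Hd w Hw).
  - intros H. apply (filterlim_locally (U := CU)). intros eps.
    destruct (H eps (cond_pos eps)) as [d [Hd H1]].
    exists (mkposreal d Hd). intros w Hw. exact (H1 w Hw).
Qed.

Lemma continuous_path_iff (g : R -> C) (t : R) :
  @continuous R_UniformSpace CU g t <->
  (forall eps, 0 < eps -> exists delta, 0 < delta /\
     forall s, Rabs (s - t) < delta -> Cmod (g s - g t) < eps).
Proof.
  split.
  - intros H eps Heps.
    destruct (proj1 (filterlim_locally (U := CU) g (g t)) H (mkposreal eps Heps)) as [d Hd].
    exists d; split; [apply cond_pos|]. intros w Hw. exact (Hd w Hw).
  - intros H. apply (filterlim_locally (U := CU)). intros eps.
    destruct (H eps (cond_pos eps)) as [d [Hd H1]].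
    exists (mkposreal d Hd). intros w Hw. exact (H1 w Hw).
Qed.

Lemma holo_deriv_continuous f z l : holo_deriv f z l -> @continuous CU CU f z.
Proof.
  intros H. apply continuous_CU_codomain.
  apply (@ex_derive_continuous C_AbsRing C_NormedModule). exists l.
  now apply is_derive_holo_deriv.
Qed.

Lemma open_C_iff (U : C -> Prop) :
  open_C U <-> (forall z, U z -> exists r, 0 < r /\ forall w, Cmod (w - z) < r -> U w).
Proof.
  split.
  - intros H z Hz. destruct (proj1 (locally_C z U) (H z Hz)) as [d Hd].
    exists d. split; [apply cond_pos| exact Hd].
  - intros H z Hz. apply locally_C. destruct (H z Hz) as [r [Hr H1]].
    exists (mkposreal r Hr). exact H1.
Qed.

Lemma holo_deriv_ext_loc f g z l r : 0 < r ->
  (forall w, Cmod (w - z) < r -> f w = g w) -> holo_deriv f z l -> holo_deriv g z l.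
Proof.
  intros Hr E H eps Heps. destruct (H eps Heps) as [d [Hd H1]].
  exists (Rmin d r). split; [now apply Rmin_pos|].
  intros w Hw. rewrite <- !E.
  apply H1. eapply Rlt_le_trans; [exact Hw|apply Rmin_l].
  replace (z - z)%C with (RtoC 0) by ring. now rewrite Cmod_0.
  eapply Rlt_le_trans; [exact Hw|apply Rmin_r].
Qed.

Lemma holo_deriv_const c z : holo_deriv (fun _ => c) z 0.
Proof. apply is_derive_holo_deriv, (@is_derive_const C_AbsRing C_NormedModule). Qed.

Lemma holo_deriv_id z : holo_deriv (fun w => w) z 1.
Proof.
  intros eps He. exists 1; split; [lra|]. intros w _.
  replace (w - z - 1 * (w - z))%C with (RtoC 0) by ring. rewrite Cmod_0.
  apply Rmult_le_pos; [lra|apply Cmod_ge_0].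
Qed.

Lemma holo_deriv_plus f g z a b : holo_deriv f z a -> holo_deriv g z b ->
  holo_deriv (fun w => f w + g w)%C z (a + b).
Proof.
  intros Hf Hg. apply is_derive_holo_deriv.
  apply (@is_derive_plus C_AbsRing C_NormedModule f g z a b); now apply is_derive_holo_deriv.
Qed.

Lemma holo_deriv_minus f g z a b : holo_deriv f z a -> holo_deriv g z b ->
  holo_deriv (fun w => f w - g w)%C z (a - b).
Proof.
  intros Hf Hg. apply is_derive_holo_deriv.
  apply (@is_derive_minus C_AbsRing C_NormedModule f g z a b); now apply is_derive_holo_deriv.
Qed.

Lemma is_derive_ring_C f z a : @is_derive C_AbsRing C_NormedModule f z a <->
   @is_derive C_AbsRing (AbsRing_NormedModule C_AbsRing) f z a.
Proof.
  split; intros [_ H]; (split; [apply is_linear_scal_l|exact H]).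
Qed.

Lemma holo_deriv_mult f g z a b : holo_deriv f z a -> holo_deriv g z b ->
  holo_deriv (fun w => f w * g w)%C z (a * g z + f z * b).
Proof.
  intros Hf Hg. apply is_derive_holo_deriv, is_derive_ring_C.
  apply (@is_derive_mult C_AbsRing f g z a b);
    [apply is_derive_ring_C; now apply is_derive_holo_deriv ..|].
  intros n m. apply Cmult_comm.
Qed.

Lemma holo_deriv_val f z l l' : holo_deriv f z l -> l = l' -> holo_deriv f z l'.
Proof. now intros H <-. Qed.

Lemma holo_deriv_scal c f z a : holo_deriv f z a -> holo_deriv (fun w => c * f w)%C z (c * a).
Proof.
  intros Hf. eapply holo_deriv_val.
  - apply holo_deriv_mult; [apply holo_deriv_const|exact Hf].
  - cbv beta; ring.
Qed.

Lemma holo_deriv_comp f g z a b : holo_deriv f (g z) a -> holo_deriv g z b ->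
  holo_deriv (fun w => f (g w)) z (a * b).
Proof.
  intros Hf Hg. apply is_derive_holo_deriv. rewrite Cmult_comm.
  apply (@is_derive_comp C_AbsRing C_NormedModule f g z a b);
    [now apply is_derive_holo_deriv | apply is_derive_ring_C; now apply is_derive_holo_deriv].
Qed.

Lemma Cmod_minus_sym (a b : C) : Cmod (a - b) = Cmod (b - a).
Proof. rewrite <- Cmod_opp. f_equal. ring. Qed.

Lemma Cmod_triangle_rev (a b : C) : Cmod a - Cmod b <= Cmod (a - b).
Proof. assert (H := Cmod_triangle (a - b) b). replace (a - b + b)%C with a in H by ring. lra. Qed.

Lemma Cmod_nz (z : C) : 0 < Cmod z -> z <> RtoC 0.
Proof. intros H ->. rewrite Cmod_0 in H. lra. Qed.

Lemma holo_deriv_inv (z : C) : z <> RtoC 0 -> holo_deriv Cinv z (- (/ (z * z))).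
Proof.
  intros Hz eps Heps.
  assert (Hm : 0 < Cmod z) by exact (proj1 (Cmod_gt_0 z) Hz).
  exists (Rmin (Cmod z / 2) (eps * Cmod z ^ 3 / 2)).
  split. { apply Rmin_pos; [lra|]. apply Rmult_lt_0_compat; [|lra]. apply Rmult_lt_0_compat; auto. now apply pow_lt. }
  intros w Hw.
  assert (H1 := Rlt_le_trans _ _ _ Hw (Rmin_l _ _)).
  assert (H2 := Rlt_le_trans _ _ _ Hw (Rmin_r _ _)).
  assert (H3 : Cmod z / 2 < Cmod w).
  { assert (H := Cmod_triangle_rev z w). rewrite Cmod_minus_sym in H. lra. }
  assert (Hw0 : w <> RtoC 0) by (apply Cmod_nz; lra).
  replace (/ w - / z - - / (z * z) * (w - z))%C with ((w - z) * (w - z) * / (z * z * w))%C by (field; auto).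
  rewrite !Cmod_mult, Cmod_inv, !Cmod_mult by (repeat apply Cmult_neq_0; auto).
  set (k := Cmod (w - z)) in *. assert (0 <= k) by apply Cmod_ge_0.
  assert (Hp : 0 < Cmod z * Cmod z * Cmod w) by (repeat apply Rmult_lt_0_compat; lra).
  apply (Rmult_le_reg_r (Cmod z * Cmod z * Cmod w)); auto.
  replace (k * k * / (Cmod z * Cmod z * Cmod w) * (Cmod z * Cmod z * Cmod w)) with (k * k) by (field; lra).
  replace (eps * k * (Cmod z * Cmod z * Cmod w)) with (k * (eps * (Cmod z * Cmod z * Cmod w))) by ring.
  apply Rmult_le_compat_l; auto. apply Rlt_le. eapply Rlt_le_trans; [exact H2|].
  replace (eps * Cmod z ^ 3 / 2) with (eps * (Cmod z * Cmod z * (Cmod z / 2))) by field.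
  apply Rmult_le_compat_l; [lra|]. apply Rmult_le_compat_l; [|lra]. apply Rmult_le_pos; lra.
Qed.

Section Cont.
Context (T : UniformSpace).
Implicit Types f g : T -> C.

Lemma ccont_const (c : C) (x : T) : @continuous T CU (fun _ => c) x.
Proof. apply continuous_const. Qed.
Lemma ccont_plus f g x : @continuous T CU f x -> @continuous T CU g x ->
  @continuous T CU (fun t => f t + g t)%C x.
Proof. apply (@continuous_plus T C_AbsRing (AbsRing_NormedModule C_AbsRing) f g x). Qed.
Lemma ccont_minus f g x : @continuous T CU f x -> @continuous T CU g x ->
  @continuous T CU (fun t => f t - g t)%C x.
Proof. apply (@continuous_minus T C_AbsRing (AbsRing_NormedModule C_AbsRing) f g x). Qed.
Lemma ccont_mult f g x : @continuous T CU f x -> @continuous T CU g x ->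
  @continuous T CU (fun t => f t * g t)%C x.
Proof. apply (@continuous_mult T C_AbsRing f g x). Qed.
Lemma ccont_comp (h : C -> C) f x : @continuous T CU f x -> @continuous CU CU h (f x) ->
  @continuous T CU (fun t => h (f t)) x.
Proof. apply (@continuous_comp T CU CU f h x). Qed.
Lemma ccont_inv f x : f x <> RtoC 0 -> @continuous T CU f x -> @continuous T CU (fun t => / f t)%C x.
Proof.
  intros H0 H. apply (ccont_comp Cinv); auto. eapply holo_deriv_continuous, holo_deriv_inv; auto.
Qed.
End Cont.

Lemma ccont_RtoC (t : R) : @continuous R_UniformSpace CU RtoC t.
Proof.
  apply continuous_path_iff. intros eps He. exists eps; split; auto.
  intros s Hs. rewrite <- RtoC_minus, Cmod_R. exact Hs.
Qed.

(** The rules are selected by the syntax of the goal: left to unification they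
    would unfold the arithmetic of [C]. *)
Ltac ccont := repeat first [assumption |
  match goal with
  | |- @continuous ?T _ (fun _ => ?c) _ => apply (ccont_const T)
  | |- @continuous ?T _ (fun t => t) _ => apply (@continuous_id T)
  | |- @continuous ?T _ (fun t => Cplus (@?f t) (@?g t)) _ => apply (ccont_plus T f g)
  | |- @continuous ?T _ (fun t => Cminus (@?f t) (@?g t)) _ => apply (ccont_minus T f g)
  | |- @continuous ?T _ (fun t => Cmult (@?f t) (@?g t)) _ => apply (ccont_mult T f g)
  | |- @continuous ?T _ (fun t => Cdiv (@?f t) (@?g t)) _ => apply (ccont_mult T f (fun t => Cinv (g t)))
  | |- @continuous ?T _ (fun t => Cinv (@?g t)) _ => apply (ccont_inv T g)
  | |- @continuous R_UniformSpace _ (fun t => RtoC t) _ => apply ccont_RtoC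
  end].

Lemma path_deriv_continuous g t v :
  @is_derive R_AbsRing C_R_NormedModule g t v -> @continuous R_UniformSpace CU g t.
Proof.
  intros H. apply continuous_CU_codomain.
  apply (@ex_derive_continuous R_AbsRing C_R_NormedModule). now exists v.
Qed.

Lemma path_deriv_comp P g t l v : holo_deriv P (g t) l ->
  @is_derive R_AbsRing C_R_NormedModule g t v ->
  @is_derive R_AbsRing C_R_NormedModule (fun s => P (g s)) t (l * v)%C.
Proof.
  intros HP Hg. apply is_derive_path_iff. intros eps He.
  assert (Hg' := proj1 (is_derive_path_iff _ _ _) Hg).
  assert (Cg := proj1 (continuous_path_iff _ _) (path_deriv_continuous _ _ _ Hg)).
  set (B := Cmod v + 1). assert (HB : 1 <= B) by (unfold B; assert (H := Cmod_ge_0 v); lra).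
  set (L := Cmod l + 1). assert (HL : 1 <= L) by (unfold L; assert (H := Cmod_ge_0 l); lra).
  destruct (HP (eps / 2 / B)) as [d1 [Hd1 H1]]. { repeat apply Rdiv_lt_0_compat; lra. }
  destruct (Cg d1 Hd1) as [d2 [Hd2 H2]].
  destruct (Hg' (Rmin 1 (eps / 2 / L))) as [d3 [Hd3 H3]].
  { apply Rmin_pos; [lra|]. repeat apply Rdiv_lt_0_compat; lra. }
  exists (Rmin d2 d3). split; [now apply Rmin_pos|]. intros s Hs.
  specialize (H2 s (Rlt_le_trans _ _ _ Hs (Rmin_l _ _))).
  specialize (H3 s (Rlt_le_trans _ _ _ Hs (Rmin_r _ _))).
  specialize (H1 (g s) H2).
  set (k := Rabs (s - t)) in *. assert (0 <= k) by apply Rabs_pos.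
  assert (H4 : Cmod (g s - g t) <= B * k).
  { replace (g s - g t)%C with ((g s - g t - v * RtoC (s - t)) + v * RtoC (s - t))%C by ring.
    eapply Rle_trans; [apply Cmod_triangle|]. rewrite Cmod_mult, Cmod_R. fold k. unfold B.
    assert (Rmin 1 (eps/2/L) * k <= 1 * k) by (apply Rmult_le_compat_r; [auto|apply Rmin_l]). lra. }
  replace (P (g s) - P (g t) - l * v * RtoC (s - t))%C with
   ((P (g s) - P (g t) - l * (g s - g t)) + l * (g s - g t - v * RtoC (s - t)))%C by ring.
  eapply Rle_trans; [apply Cmod_triangle|]. rewrite Cmod_mult.
  assert (H5 : Cmod (P (g s) - P (g t) - l * (g s - g t)) <= eps / 2 * k).
  { eapply Rle_trans; [exact H1|].
    apply Rle_trans with (eps/2/B * (B * k)). apply Rmult_le_compat_l; auto.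
    apply Rlt_le; repeat apply Rdiv_lt_0_compat; lra. right; field; lra. }
  assert (H6 : Cmod l * Cmod (g s - g t - v * RtoC (s - t)) <= eps / 2 * k).
  { apply Rle_trans with (L * (eps/2/L * k)).
    apply Rmult_le_compat; try apply Cmod_ge_0. unfold L; lra.
    eapply Rle_trans; [exact H3|]. apply Rmult_le_compat_r; auto. apply Rmin_r.
    right; field; lra. }
  lra.
Qed.

Definition path_int (f : R -> C) (a b : R) : C := @RInt C_R_CompleteNormedModule f a b.
Definition path_continuous_on (f : R -> C) (a b : R) : Prop :=
  forall t, a <= t <= b -> @continuous R_UniformSpace CU f t.

Lemma path_int_ex f a b : a <= b -> path_continuous_on f a b -> @ex_RInt C_R_NormedModule f a b.
Proof.
  intros Hab H. apply (@ex_RInt_continuous C_R_CompleteNormedModule).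
  rewrite Rmin_left, Rmax_right by auto. intros t Ht. apply continuous_CU_codomain. now apply H.
Qed.

Lemma path_int_is f a b : a <= b -> path_continuous_on f a b -> @is_RInt C_R_NormedModule f a b (path_int f a b).
Proof. intros Hab H. apply (@RInt_correct C_R_CompleteNormedModule). now apply path_int_ex. Qed.

Lemma path_int_unique f a b l : @is_RInt C_R_NormedModule f a b l -> path_int f a b = l.
Proof. apply (@is_RInt_unique C_R_CompleteNormedModule). Qed.

Lemma path_int_ext f g a b : a <= b -> (forall t, a <= t <= b -> f t = g t) -> path_int f a b = path_int g a b.
Proof.
  intros Hab H. apply (@RInt_ext C_R_CompleteNormedModule).
  rewrite Rmin_left, Rmax_right by auto. intros; apply H; lra.
Qed.

Lemma path_int_minus f g a b : a <= b -> path_continuous_on f a b -> path_continuous_on g a b ->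
  path_int (fun t => f t - g t)%C a b = (path_int f a b - path_int g a b)%C.
Proof.
  intros Hab Hf Hg. apply path_int_unique.
  apply (@is_RInt_minus C_R_NormedModule f g a b); now apply path_int_is.
Qed.

(** The integral is real linear by construction; complex scalars need a look
    at the two components. *)
Lemma path_int_scal c f a b : a <= b -> path_continuous_on f a b ->
  path_int (fun t => c * f t)%C a b = (c * path_int f a b)%C.
Proof.
  intros Hab Hf. apply path_int_unique.
  assert (H := path_int_is f a b Hab Hf).
  assert (H1 := @is_RInt_fct_extend_fst R_NormedModule R_NormedModule f a b _ H).
  assert (H2 := @is_RInt_fct_extend_snd R_NormedModule R_NormedModule f a b _ H).
  apply (@is_RInt_fct_extend_pair R_NormedModule R_NormedModule).
  - apply (is_RInt_minus (V := R_NormedModule)); apply (is_RInt_scal (V := R_NormedModule)); auto.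
  - apply (is_RInt_plus (V := R_NormedModule)); apply (is_RInt_scal (V := R_NormedModule)); auto.
Qed.

Lemma path_int_bound f a b M : a <= b -> path_continuous_on f a b ->
  (forall t, a <= t <= b -> Cmod (f t) <= M) -> Cmod (path_int f a b) <= (b - a) * M.
Proof.
  intros Hab Hf HM. rewrite <- norm_C_R.
  apply (@norm_RInt_le_const C_R_NormedModule f a b); auto.
  - intros t Ht. rewrite norm_C_R. auto.
  - now apply path_int_is.
Qed.

Lemma path_int_FTC P p a b : a <= b ->
  (forall t, a <= t <= b -> @is_derive R_AbsRing C_R_NormedModule P t (p t)) -> path_continuous_on p a b ->
  path_int p a b = (P b - P a)%C.
Proof.
  intros Hab HP Hp. apply path_int_unique.
  apply (@is_RInt_derive C_R_CompleteNormedModule P p a b);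
  rewrite Rmin_left, Rmax_right by auto; auto.
  intros t Ht. apply continuous_CU_codomain. now apply Hp.
Qed.

Lemma path_int_Chasles f a b c : a <= b -> b <= c -> path_continuous_on f a c ->
  (path_int f a b + path_int f b c)%C = path_int f a c.
Proof.
  intros H1 H2 H. apply (@RInt_Chasles C_R_CompleteNormedModule); apply path_int_ex; auto;
  intros t Ht; apply H; lra.
Qed.

(** * Goursat's lemma and local primitives *)

Lemma C_derive_spec f z : (exists l, holo_deriv f z l) -> holo_deriv f z (C_derive f z).
Proof.
  intros [l Hl]. rewrite (is_C_derive_unique f z l); auto. now apply is_derive_holo_deriv.
Qed.

Definition seg (a b : C) (t : R) : C := (a + RtoC t * (b - a))%C.

Definition seg_int (f : C -> C) (a b : C) : C := path_int (fun t => f (seg a b t) * (b - a))%C 0 1.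

Lemma seg_ball (c : C) r a b t : 0 <= t <= 1 -> Cmod (a - c) < r -> Cmod (b - c) < r -> Cmod (seg a b t - c) < r.
Proof.
  intros Ht Ha Hb. unfold seg.
  replace (a + t * (b - a) - c)%C with (RtoC (1 - t) * (a - c) + RtoC t * (b - c))%C by (rewrite RtoC_minus; ring).
  eapply Rle_lt_trans; [apply Cmod_triangle|]. rewrite !Cmod_mult, !Cmod_R, !Rabs_pos_eq by lra.
  destruct (Req_dec t 0) as [->|H0]; [lra|].
  assert ((1 - t) * Cmod (a - c) <= (1 - t) * r) by (apply Rmult_le_compat_l; lra).
  assert (t * Cmod (b - c) < t * r) by (apply Rmult_lt_compat_l; lra). lra.
Qed.

Lemma seg_closed_ball (c : C) r a b t : 0 <= t <= 1 -> Cmod (a - c) <= r -> Cmod (b - c) <= r -> Cmod (seg a b t - c) <= r.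
Proof.
  intros Ht Ha Hb. unfold seg.
  replace (a + t * (b - a) - c)%C with (RtoC (1 - t) * (a - c) + RtoC t * (b - c))%C by (rewrite RtoC_minus; ring).
  eapply Rle_trans; [apply Cmod_triangle|]. rewrite !Cmod_mult, !Cmod_R, !Rabs_pos_eq by lra.
  assert ((1 - t) * Cmod (a - c) <= (1 - t) * r) by (apply Rmult_le_compat_l; lra).
  assert (t * Cmod (b - c) <= t * r) by (apply Rmult_le_compat_l; lra). lra.
Qed.

Lemma seg_derive a b t : @is_derive R_AbsRing C_R_NormedModule (seg a b) t (b - a)%C.
Proof.
  apply is_derive_path_iff. intros eps He. exists 1; split; [lra|]. intros s _.
  unfold seg. replace (a + s * (b - a) - (a + t * (b - a)) - (b - a) * (RtoC (s - t)))%C with (RtoC 0).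
  rewrite Cmod_0. apply Rmult_le_pos; [lra|apply Rabs_pos]. rewrite RtoC_minus; ring.
Qed.

Definition cont_along (f : C -> C) a b := forall t, 0 <= t <= 1 -> @continuous CU CU f (seg a b t).

Lemma seg_continuous f a b : cont_along f a b -> path_continuous_on (fun t => f (seg a b t) * (b - a))%C 0 1.
Proof.
  intros H t Ht. apply (ccont_mult _); [|ccont].
  apply (ccont_comp _); auto. eapply path_deriv_continuous, seg_derive.
Qed.

Lemma seg_int_FTC P p a b : (forall t, 0 <= t <= 1 -> holo_deriv P (seg a b t) (p (seg a b t))) ->
  cont_along p a b -> seg_int p a b = (P b - P a)%C.
Proof.
  intros HP Hp. unfold seg_int.
  rewrite (path_int_FTC (fun t => P (seg a b t))); [|lra| |now apply seg_continuous].
  - unfold seg. f_equal; [|do 2 f_equal]; f_equal; ring.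
  - intros t Ht. apply path_deriv_comp; [auto|apply seg_derive].
Qed.

Lemma seg_int_minus f g a b : cont_along f a b -> cont_along g a b ->
  seg_int (fun z => f z - g z)%C a b = (seg_int f a b - seg_int g a b)%C.
Proof.
  intros Hf Hg. unfold seg_int.
  rewrite <- path_int_minus; [|lra|now apply seg_continuous ..].
  apply path_int_ext; [lra|]. intros; ring.
Qed.

Lemma seg_int_bound f a b M : cont_along f a b -> (forall t, 0 <= t <= 1 -> Cmod (f (seg a b t)) <= M) ->
  Cmod (seg_int f a b) <= M * Cmod (b - a).
Proof.
  intros Hf HM. unfold seg_int. replace (M * Cmod (b - a)) with ((1 - 0) * (M * Cmod (b - a))) by ring.
  apply path_int_bound; [lra|now apply seg_continuous|].
  intros t Ht. rewrite Cmod_mult. apply Rmult_le_compat_r; [apply Cmod_ge_0|auto].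
Qed.

Lemma seg_int_const c a b : seg_int (fun _ => c) a b = (c * (b - a))%C.
Proof.
  rewrite (seg_int_FTC (fun z => c * z)%C).
  - ring.
  - intros t _. eapply holo_deriv_val; [apply holo_deriv_scal, holo_deriv_id|ring].
  - intros t _. ccont.
Qed.

(** The mean value inequality: [P b - P a] is the integral of [p] along the
    segment, and [L * (b - a)] that of the constant [L]. *)
Lemma mean_value_bound P p a b L M :
  (forall t, 0 <= t <= 1 -> holo_deriv P (seg a b t) (p (seg a b t))) ->
  cont_along p a b -> (forall t, 0 <= t <= 1 -> Cmod (p (seg a b t) - L) <= M) ->
  Cmod (P b - P a - L * (b - a)) <= M * Cmod (b - a).
Proof.
  intros HP Hp HM. rewrite <- (seg_int_FTC P p a b HP Hp), <- seg_int_const, <- seg_int_minus; auto.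
  - apply seg_int_bound; auto. intros t Ht. ccont. now apply Hp.
  - intros t _. ccont.
Qed.

(** Both halves are the whole integral restricted to half of the parameter
    interval, after an affine change of variable. *)
Lemma seg_int_midpoint f a b : cont_along f a b ->
  (seg_int f a (seg a b (1/2)) + seg_int f (seg a b (1/2)) b)%C = seg_int f a b.
Proof.
  intros H. assert (Hc := seg_continuous f a b H).
  set (g := fun t => (f (seg a b t) * (b - a))%C) in Hc.
  assert (E1 : seg_int f a (seg a b (1/2)) = path_int g 0 (1/2)).
  { transitivity (path_int g (1/2 * 0 + 0) (1/2 * 1 + 0)); [|f_equal; lra].
    symmetry. unfold path_int. rewrite <- (@RInt_comp_lin C_R_CompleteNormedModule).
    - apply path_int_ext; [lra|]. intros t _. rewrite scal_R_Cmult. unfold g, seg.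
      replace (a + RtoC (1/2 * t + 0) * (b - a))%C with (a + t * (a + RtoC (1/2) * (b - a) - a))%C.
      ring. rewrite RtoC_plus, RtoC_mult. ring.
    - apply path_int_ex; [lra|]. intros t Ht; apply Hc; lra. }
  assert (E2 : seg_int f (seg a b (1/2)) b = path_int g (1/2) 1).
  { transitivity (path_int g (1/2 * 0 + 1/2) (1/2 * 1 + 1/2)); [|f_equal; lra].
    symmetry. unfold path_int. rewrite <- (@RInt_comp_lin C_R_CompleteNormedModule).
    - assert (Eh : (RtoC 1 = RtoC (1/2) + RtoC (1/2))%C) by (rewrite <- RtoC_plus; f_equal; lra).
      assert (Em : (b - seg a b (1/2) = RtoC (1/2) * (b - a))%C).
      { unfold seg. transitivity ((RtoC 1 - RtoC (1/2)) * (b - a))%C; [ring|rewrite Eh; ring]. }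
      apply path_int_ext; [lra|]. intros t _. rewrite scal_R_Cmult. unfold g. rewrite Em.
      replace (seg (seg a b (1/2)) b t) with (seg a b (1/2 * t + 1/2)). ring.
      unfold seg at 2. rewrite Em. unfold seg. rewrite RtoC_plus, RtoC_mult. ring.
    - apply path_int_ex; [lra|]. intros t Ht; apply Hc; lra. }
  rewrite E1, E2. apply path_int_Chasles; auto; lra.
Qed.

Lemma seg_int_swap f a b : cont_along f a b -> seg_int f b a = (- seg_int f a b)%C.
Proof.
  intros H. assert (Hc := seg_continuous f a b H).
  set (g := fun t => (f (seg a b t) * (b - a))%C) in Hc.
  transitivity (@RInt C_R_CompleteNormedModule g (-1 * 0 + 1) (-1 * 1 + 1)).
  - symmetry. rewrite <- (@RInt_comp_lin C_R_CompleteNormedModule).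
    + apply path_int_ext; [lra|]. intros t _. rewrite scal_R_Cmult. unfold g.
      replace (seg b a t) with (seg a b (-1 * t + 1)).
      replace (RtoC (-1)) with (- RtoC 1)%C by (rewrite <- RtoC_opp; f_equal; lra). ring.
      unfold seg. replace (-1 * t + 1) with (1 - t) by ring. rewrite RtoC_minus. ring.
    + apply (@ex_RInt_swap C_R_NormedModule).
      replace (-1 * 1 + 1) with 0 by ring. replace (-1 * 0 + 1) with 1 by ring.
      apply path_int_ex; auto; lra.
  - replace (-1 * 1 + 1) with 0 by ring. replace (-1 * 0 + 1) with 1 by ring.
    rewrite <- (@opp_RInt_swap C_R_CompleteNormedModule); [reflexivity|].
    apply path_int_ex; auto; lra.
Qed.

Definition tri_int f a b c := (seg_int f a b + seg_int f b c + seg_int f c a)%C.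

Lemma Cmod_le_sum (z : C) : Cmod z <= Rabs (fst z) + Rabs (snd z).
Proof.
  replace z with (RtoC (fst z) + Ci * RtoC (snd z))%C at 1.
  eapply Rle_trans; [apply Cmod_triangle|]. rewrite Cmod_mult, !Cmod_R, Cmod_Ci. lra.
  destruct z as [x y]. unfold RtoC, Ci, Cplus, Cmult; simpl. f_equal; ring.
Qed.

Lemma im_le_Cmod (z : C) : Rabs (snd z) <= Cmod z.
Proof. eapply Rle_trans; [apply Rmax_r|apply Rmax_Cmod]. Qed.

Lemma pow_half_small D eps : 0 <= D -> 0 < eps -> exists N, forall k, (N <= k)%nat -> D * (/2) ^ k < eps.
Proof.
  intros HD He. destruct (pow_lt_1_zero (/2)) with (y := eps / (D + 1)) as [N HN].
  rewrite Rabs_pos_eq; lra. apply Rdiv_lt_0_compat; lra.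
  exists N. intros k Hk. specialize (HN k Hk).
  assert (Hp : 0 < (/2)^k) by (apply pow_lt; lra).
  rewrite Rabs_pos_eq in HN by lra.
  apply Rle_lt_trans with ((D + 1) * (/2)^k). apply Rmult_le_compat_r; lra.
  replace eps with ((D+1) * (eps / (D+1))) by (field; lra). apply Rmult_lt_compat_l; lra.
Qed.

(** Such a sequence is Cauchy in each coordinate, and the tail of the
    geometric series bounds the distance to the limit. *)
Lemma geometric_limit (a : nat -> C) D :
  (forall k, Cmod (a (S k) - a k) <= D * (/2) ^ S k) ->
  exists p, forall k, Cmod (a k - p) <= D * (/2) ^ k.
Proof.
  intros Ha.
  assert (HD : 0 <= D). { specialize (Ha O). assert (H := Cmod_ge_0 (a 1%nat - a O)). simpl in Ha. lra. }
  assert (H1 : forall k j, Cmod (a (k + j)%nat - a k) <= D * (/2)^k - D * (/2) ^ (k + j)).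
  { intros k; induction j as [|j IH].
    - rewrite Nat.add_0_r. replace (a k - a k)%C with (RtoC 0) by ring. rewrite Cmod_0; lra.
    - rewrite Nat.add_succ_r. replace (a (S (k + j)) - a k)%C with ((a (S (k+j)) - a (k+j)%nat) + (a (k+j)%nat - a k))%C by ring.
      eapply Rle_trans; [apply Cmod_triangle|]. specialize (Ha (k + j)%nat). simpl pow in *. lra. }
  assert (H2 : forall k m, (k <= m)%nat -> Cmod (a m - a k) <= D * (/2)^k).
  { intros k m Hk. replace m with (k + (m - k))%nat by lia. eapply Rle_trans; [apply H1|].
    assert (0 <= D * (/2)^(k + (m - k))) by (apply Rmult_le_pos; auto; apply Rlt_le, pow_lt; lra). lra. }
  assert (Hco : forall pr : C -> R, (forall x y : C, Rabs (pr x - pr y) <= Cmod (x - y)) ->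
     exists l, is_lim_seq (fun n => pr (a n)) (Finite l)).
  { intros pr Hpr. apply ex_lim_seq_cauchy_corr. intros eps.
    destruct (pow_half_small D (eps/2) HD) as [N HN]. apply Rdiv_lt_0_compat; [apply cond_pos|lra].
    exists N. intros n m Hn Hm. eapply Rle_lt_trans; [apply Hpr|].
    replace (a n - a m)%C with ((a n - a N) + (a N - a m))%C by ring.
    eapply Rle_lt_trans; [apply Cmod_triangle|]. rewrite (Cmod_minus_sym (a N)).
    specialize (HN N (le_n N)). assert (K1 := H2 N n Hn). assert (K2 := H2 N m Hm). lra. }
  destruct (Hco fst) as [x Hx]. { intros. apply (re_le_Cmod (x - y)). }
  destruct (Hco snd) as [y Hy]. { intros. apply (im_le_Cmod (x0 - y)). }
  exists ((x, y) : C). intros k. apply le_epsilon. intros eps He.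
  destruct (proj2 (is_lim_seq_spec _ _) Hx (mkposreal (eps/2) ltac:(lra))) as [N1 HN1].
  destruct (proj2 (is_lim_seq_spec _ _) Hy (mkposreal (eps/2) ltac:(lra))) as [N2 HN2].
  set (m := (k + N1 + N2)%nat).
  specialize (HN1 m ltac:(unfold m; lia)). specialize (HN2 m ltac:(unfold m; lia)). simpl in HN1, HN2.
  replace (a k - (x, y))%C with ((a k - a m) + (a m - (x, y)))%C by ring.
  eapply Rle_trans; [apply Cmod_triangle|]. rewrite (Cmod_minus_sym (a k)).
  assert (K := H2 k m ltac:(unfold m; lia)).
  assert (K2 := Cmod_le_sum (a m - (x, y))). simpl in K2.
  change (fst (a m) + - x) with (fst (a m) - x) in K2. change (snd (a m) + - y) with (snd (a m) - y) in K2. lra.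
Qed.

Definition triangle := (C * C * C)%type.
Definition perimeter (s : triangle) : R := let '(a, b, c) := s in Cmod (b - a) + Cmod (c - b) + Cmod (a - c).
Definition tri (f : C -> C) (s : triangle) : C := let '(a, b, c) := s in tri_int f a b c.
Definition apex (s : triangle) : C := let '(a, b, c) := s in a.
Definition in_closed_ball (c : C) r (s : triangle) := let '(x, y, z) := s in
  Cmod (x - c) <= r /\ Cmod (y - c) <= r /\ Cmod (z - c) <= r.

Lemma four_max (u1 u2 u3 u4 : C) : exists i : nat,
  Cmod (u1 + u2 + u3 + u4) <= 4 * Cmod (match i with 0 => u1 | 1 => u2 | 2 => u3 | _ => u4 end)%nat.
Proof.
  assert (H := Cmod_triangle (u1 + u2 + u3) u4). assert (H1 := Cmod_triangle (u1 + u2) u3).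
  assert (H2 := Cmod_triangle u1 u2).
  destruct (Rle_dec (Cmod (u1 + u2 + u3 + u4)) (4 * Cmod u1)); [now exists O|].
  destruct (Rle_dec (Cmod (u1 + u2 + u3 + u4)) (4 * Cmod u2)); [now exists 1%nat|].
  destruct (Rle_dec (Cmod (u1 + u2 + u3 + u4)) (4 * Cmod u3)); [now exists 2%nat|].
  exists 3%nat. lra.
Qed.

Lemma Cmod_half (z : C) : Cmod (RtoC (1/2) * z) = Cmod z / 2.
Proof. rewrite Cmod_mult, Cmod_R, Rabs_pos_eq; lra. Qed.

(** The midpoints of the sides cut a triangle into four, the integrals along
    the inner sides cancel, and so one of the four carries at least a quarter
    of the integral; every side of the four is half a side of the original. *)
Lemma triangle_step f c r s :
  (forall z, Cmod (z - c) <= r -> @continuous CU CU f z) -> in_closed_ball c r s ->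
  exists s', in_closed_ball c r s' /\ Cmod (tri f s) <= 4 * Cmod (tri f s') /\
    perimeter s' = perimeter s / 2 /\ Cmod (apex s' - apex s) <= perimeter s / 2.
Proof.
  intros Hf. destruct s as [[x y] z]. intros [Hx [Hy Hz]].
  set (m1 := seg x y (1/2)). set (m2 := seg y z (1/2)). set (m3 := seg z x (1/2)).
  assert (Hm1 : Cmod (m1 - c) <= r) by (apply seg_closed_ball; auto; lra).
  assert (Hm2 : Cmod (m2 - c) <= r) by (apply seg_closed_ball; auto; lra).
  assert (Hm3 : Cmod (m3 - c) <= r) by (apply seg_closed_ball; auto; lra).
  assert (Hc : forall a b, Cmod (a - c) <= r -> Cmod (b - c) <= r -> cont_along f a b).
  { intros a b Ha Hb t Ht. apply Hf. now apply seg_closed_ball. }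
  assert (E : tri f (x, y, z) = (tri f (x, m1, m3) + tri f (m1, y, m2) + tri f (m3, m2, z) + tri f (m1, m2, m3))%C).
  { simpl. unfold tri_int.
    rewrite <- (seg_int_midpoint f x y), <- (seg_int_midpoint f y z), <- (seg_int_midpoint f z x) by auto.
    fold m1 m2 m3.
    rewrite (seg_int_swap f m1 m3), (seg_int_swap f m1 m2), (seg_int_swap f m2 m3) by auto. ring. }
  destruct (four_max (tri f (x, m1, m3)) (tri f (m1, y, m2)) (tri f (m3, m2, z)) (tri f (m1, m2, m3))) as [i Hi].
  rewrite <- E in Hi.
  assert (Eh : (RtoC 1 = RtoC (1/2) + RtoC (1/2))%C) by (rewrite <- RtoC_plus; f_equal; lra).
  assert (HH : forall u v w : C, (w = RtoC (1/2) * (u - v))%C -> Cmod w = Cmod (u - v) / 2)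
    by (intros u v w ->; apply Cmod_half).
  assert (D1 : forall a b : C, (seg a b (1/2) - a = RtoC (1/2) * (b - a))%C) by (intros; unfold seg; ring).
  assert (D2 : forall a b : C, (b - seg a b (1/2) = RtoC (1/2) * (b - a))%C).
  { intros; unfold seg. transitivity ((RtoC 1 - RtoC (1/2)) * (b - a))%C; [ring|rewrite Eh; ring]. }
  assert (A1 : (m1 - x = RtoC (1/2) * (y - x))%C) by apply D1.
  assert (A2 : (y - m1 = RtoC (1/2) * (y - x))%C) by apply D2.
  assert (A3 : (m2 - y = RtoC (1/2) * (z - y))%C) by apply D1.
  assert (A4 : (z - m2 = RtoC (1/2) * (z - y))%C) by apply D2.
  assert (A5 : (m3 - z = RtoC (1/2) * (x - z))%C) by apply D1.
  assert (A6 : (x - m3 = RtoC (1/2) * (x - z))%C) by apply D2.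
  assert (B1 : (m3 - m1 = RtoC (1/2) * (z - y))%C).
  { transitivity (- (x - m3) - (m1 - x))%C; [ring|]. rewrite A6, A1; ring. }
  assert (B2 : (m1 - m2 = RtoC (1/2) * (x - z))%C).
  { transitivity (- (y - m1) - (m2 - y))%C; [ring|]. rewrite A2, A3; ring. }
  assert (B3 : (m2 - m3 = RtoC (1/2) * (y - x))%C).
  { transitivity (- (z - m2) - (m3 - z))%C; [ring|]. rewrite A4, A5; ring. }
  assert (N := fun u v => Cmod_ge_0 (u - v)).
  assert (N1 := N y x). assert (N2 := N z y). assert (N3 := N x z). clear N.
  apply HH in A1, A2, A3, A4, A5, A6, B1, B2, B3.
  destruct i as [|[|[|i]]];
  [exists (x, m1, m3)|exists (m1, y, m2)|exists (m3, m2, z)|exists (m1, m2, m3)];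
  (split; [simpl; auto|split; [exact Hi|split]]); simpl.
  - rewrite A1, B1, A6. lra.
  - replace (x - x)%C with (RtoC 0) by ring. rewrite Cmod_0. lra.
  - rewrite A2, A3, B2. lra.
  - rewrite A1. lra.
  - rewrite B3, A4, A5. lra.
  - rewrite (Cmod_minus_sym m3 x), A6. lra.
  - rewrite (Cmod_minus_sym m2 m1), (Cmod_minus_sym m3 m2), (Cmod_minus_sym m1 m3), B1, B2, B3. lra.
  - rewrite A1. lra.
Qed.

Lemma triangle_sequence f c r s :
  (forall z, Cmod (z - c) <= r -> @continuous CU CU f z) -> in_closed_ball c r s ->
  exists u : nat -> triangle, forall k,
    in_closed_ball c r (u k) /\ Cmod (tri f s) <= 4 ^ k * Cmod (tri f (u k)) /\
    perimeter (u k) = perimeter s * (/2) ^ k /\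
    Cmod (apex (u (S k)) - apex (u k)) <= perimeter s * (/2) ^ S k.
Proof.
  intros Hf Hs.
  set (next := fun w : {w | in_closed_ball c r w} =>
    let '(exist w' H) := constructive_indefinite_description _ (triangle_step f c r (proj1_sig w) Hf (proj2_sig w)) in
    exist (in_closed_ball c r) w' (proj1 H)).
  assert (Hn : forall w, Cmod (tri f (proj1_sig w)) <= 4 * Cmod (tri f (proj1_sig (next w))) /\
    perimeter (proj1_sig (next w)) = perimeter (proj1_sig w) / 2 /\
    Cmod (apex (proj1_sig (next w)) - apex (proj1_sig w)) <= perimeter (proj1_sig w) / 2).
  { intros w. unfold next. destruct (constructive_indefinite_description _ _) as [w' H]. simpl. tauto. }
  set (u := fun k => Nat.iter k next (exist _ s Hs)).
  exists (fun k => proj1_sig (u k)).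
  assert (P : forall k, perimeter (proj1_sig (u k)) = perimeter s * (/2)^k).
  { induction k as [|k IH]; [simpl; lra|].
    transitivity (perimeter (proj1_sig (u k)) / 2); [apply (Hn (u k))|]. rewrite IH. simpl; lra. }
  intros k. cbv beta. split; [apply (proj2_sig (u k))|]. split; [|split; [apply P|]].
  - induction k as [|k IH]; [simpl; lra|]. eapply Rle_trans; [exact IH|].
    assert (Hk := proj1 (Hn (u k))). change (next (u k)) with (u (S k)) in Hk.
    rewrite <- tech_pow_Rmult, (Rmult_comm 4), Rmult_assoc.
    apply Rmult_le_compat_l; [apply pow_le; lra|exact Hk].
  - eapply Rle_trans; [apply (Hn (u k))|]. rewrite P. simpl; lra.
Qed.

(** Halving shrinks the triangles to a point [p], where [f] is affine up to an
    error that is small compared with the diameter. The integral over the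
    [k]-th triangle is therefore small compared with [4 ^ - k], while it is at
    least [4 ^ - k] times the integral over the first. *)
Theorem goursat f c R : (forall z, Cmod (z - c) < R -> exists l, holo_deriv f z l) ->
  forall x y z, Cmod (x - c) < R -> Cmod (y - c) < R -> Cmod (z - c) < R -> tri_int f x y z = 0.
Proof.
  intros Hf x y z Hx Hy Hz.
  set (r := Rmax (Cmod (x - c)) (Rmax (Cmod (y - c)) (Cmod (z - c)))).
  assert (Hr : r < R) by (unfold r; repeat apply Rmax_lub_lt; auto).
  assert (Hs : in_closed_ball c r (x, y, z)).
  { simpl. unfold r. repeat split. apply Rmax_l. eapply Rle_trans; [|apply Rmax_r]; apply Rmax_l.
    eapply Rle_trans; [|apply Rmax_r]; apply Rmax_r. }
  assert (Hc : forall w, Cmod (w - c) <= r -> @continuous CU CU f w).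
  { intros w Hw. destruct (Hf w) as [l Hl]. lra. eapply holo_deriv_continuous; eauto. }
  destruct (triangle_sequence f c r (x, y, z) Hc Hs) as [u Hu].
  set (D := perimeter (x, y, z)) in Hu.
  assert (HD : 0 <= D). { unfold D; simpl. assert (N := fun u v => Cmod_ge_0 (u - v)).
    assert (N1 := N y x). assert (N2 := N z y). assert (N3 := N x z). lra. }
  destruct (geometric_limit (fun k => apex (u k)) D) as [p Hp]. { intros k; apply Hu. }
  assert (Hpc : Cmod (p - c) <= r).
  { apply le_epsilon. intros eps He. destruct (pow_half_small D eps HD He) as [N HN].
    specialize (HN N (le_n _)). specialize (Hp N). destruct (Hu N) as [Hin _].
    replace (p - c)%C with (- (apex (u N) - p) + (apex (u N) - c))%C by ring.
    eapply Rle_trans; [apply Cmod_triangle|]. rewrite Cmod_opp.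
    assert (Cmod (apex (u N) - c) <= r). { destruct (u N) as [[a b] d]. apply Hin. } lra. }
  destruct (Hf p) as [l Hl]; [lra|].
  apply Cmod_eq_0. apply Rle_antisym; [|apply Cmod_ge_0].
  apply le_epsilon. intros eps He. rewrite Rplus_0_l.
  set (e := eps / (2 * D * D + 1)).
  assert (HDD : 0 <= D * D) by now apply Rmult_le_pos.
  assert (He' : 0 < e) by (apply Rdiv_lt_0_compat; lra).
  destruct (Hl e He') as [d [Hd H1]].
  destruct (pow_half_small (2 * D) d) as [N HN]; [lra|auto|]. specialize (HN N (le_n _)).
  specialize (Hp N). destruct (Hu N) as [Hin [HT [Hper _]]].
  set (q := (/2)^N) in *. assert (Hq : 0 < q) by (apply pow_lt; lra).
  (* On the [N]-th triangle, of perimeter [D * q] and within [2 * D * q] of [p],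
     [f] differs from its affine approximation [g] by at most [e * (2 * D * q)],
     and [g] has a primitive, so that it integrates to zero. *)
  destruct (u N) as [[a1 a2] a3]. simpl in Hp, Hin, HT, Hper.
  set (g := fun w => (f p + l * (w - p))%C).
  assert (Hg : forall w, holo_deriv (fun w => f p * w + l * / 2 * ((w - p) * (w - p)))%C w (g w)).
  { intros w. unfold g.
    assert (Hid : holo_deriv (fun w => (w - p)%C) w (1 - 0)%C) by (apply holo_deriv_minus; [apply holo_deriv_id|apply holo_deriv_const]).
    eapply holo_deriv_val.
    - apply holo_deriv_plus; apply holo_deriv_scal; [apply holo_deriv_id|apply holo_deriv_mult; exact Hid].
    - simpl. field. }
  assert (Hgc : forall w, @continuous CU CU g w).
  { intros w. unfold g. ccont. }
  assert (Hg0 : forall a b, seg_int g a b = ((f p * b + l * / 2 * ((b - p) * (b - p))) - (f p * a + l * / 2 * ((a - p) * (a - p))))%C).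
  { intros a b. apply (seg_int_FTC (fun w => f p * w + l * / 2 * ((w - p) * (w - p)))%C); intros t _; auto. }
  assert (N0 := fun u v => Cmod_ge_0 (u - v)).
  assert (N1 := N0 a2 a1). assert (N2 := N0 a3 a2). assert (N3 := N0 a1 a3).
  assert (near : forall w, List.In w (a1 :: a2 :: a3 :: nil)%list -> Cmod (w - p) <= 2 * D * q).
  { intros w Hw. replace (w - p)%C with ((w - a1) + (a1 - p))%C by ring.
    eapply Rle_trans; [apply Cmod_triangle|].
    assert (Cmod (w - a1) <= D * q); [|lra]. rewrite <- Hper.
    destruct Hw as [<-|[<-|[<-|[]]]].
    - replace (a1 - a1)%C with (RtoC 0) by ring. rewrite Cmod_0. lra.
    - lra.
    - rewrite (Cmod_minus_sym a3 a1); lra. }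
  assert (Hseg : forall a b, List.In a (a1 :: a2 :: a3 :: nil)%list -> List.In b (a1 :: a2 :: a3 :: nil)%list ->
     Cmod (seg_int f a b - seg_int g a b) <= e * (2 * D * q) * Cmod (b - a)).
  { intros a b Ha Hb.
    assert (Hcf : cont_along f a b).
    { intros t Ht. apply Hc. apply seg_closed_ball; auto.
      destruct Ha as [<-|[<-|[<-|[]]]]; tauto. destruct Hb as [<-|[<-|[<-|[]]]]; tauto. }
    assert (Hcg : cont_along g a b) by (intros t _; auto).
    rewrite <- seg_int_minus by auto. apply seg_int_bound.
    - intros t Ht. ccont; [now apply Hcf|apply Hgc].
    - intros t Ht. assert (Hn : Cmod (seg a b t - p) <= 2 * D * q) by (apply seg_closed_ball; auto).
      unfold g. replace (f (seg a b t) - (f p + l * (seg a b t - p)))%C with (f (seg a b t) - f p - l * (seg a b t - p))%C by ring.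
      eapply Rle_trans; [apply H1; lra|]. apply Rmult_le_compat_l; lra. }
  assert (K1 := Hseg a1 a2 ltac:(simpl; auto) ltac:(simpl; auto)).
  assert (K2 := Hseg a2 a3 ltac:(simpl; auto) ltac:(simpl; auto)).
  assert (K3 := Hseg a3 a1 ltac:(simpl; auto) ltac:(simpl; auto)).
  assert (K : Cmod (tri_int f a1 a2 a3) <= e * (2 * D * q) * (D * q)).
  { rewrite <- Hper.
    replace (tri_int f a1 a2 a3) with ((seg_int f a1 a2 - seg_int g a1 a2) + (seg_int f a2 a3 - seg_int g a2 a3) + (seg_int f a3 a1 - seg_int g a3 a1))%C
      by (unfold tri_int; rewrite !Hg0; ring).
    eapply Rle_trans; [apply Cmod_triangle|]. eapply Rle_trans; [apply Rplus_le_compat_r, Cmod_triangle|]. lra. }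
  eapply Rle_trans; [exact HT|].
  apply Rle_trans with (4^N * (e * (2 * D * q) * (D * q))).
  { apply Rmult_le_compat_l; [apply pow_le; lra|exact K]. }
  assert (Hq4 : 4 ^ N * (q * q) = 1).
  { unfold q. rewrite <- !Rpow_mult_distr. replace (4 * (/2 * /2)) with 1 by lra. apply pow1. }
  replace (4 ^ N * (e * (2 * D * q) * (D * q))) with (e * (2 * D * D) * (4 ^ N * (q * q))) by ring.
  rewrite Hq4, Rmult_1_r. unfold e.
  apply Rmult_le_reg_r with (2 * D * D + 1); [lra|].
  replace (eps / (2 * D * D + 1) * (2 * D * D) * (2 * D * D + 1)) with (eps * (2 * D * D)) by (field; lra).
  apply Rmult_le_compat_l; lra.
Qed.

(** The primitive is the integral along the segment from the centre; Goursat's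
    lemma turns its increments into integrals along short segments. *)
Theorem primitive_ball f c R : (forall z, Cmod (z - c) < R -> exists l, holo_deriv f z l) ->
  exists P, forall z, Cmod (z - c) < R -> holo_deriv P z (f z).
Proof.
  intros Hf. exists (seg_int f c). intros z Hz eps He.
  assert (Hcf : forall w, Cmod (w - c) < R -> @continuous CU CU f w).
  { intros w Hw. destruct (Hf w Hw) as [l Hl]. eapply holo_deriv_continuous; eauto. }
  assert (HR : Cmod (c - c) < R). { replace (c - c)%C with (RtoC 0) by ring. rewrite Cmod_0.
    eapply Rle_lt_trans; [apply Cmod_ge_0|exact Hz]. }
  assert (Hca : forall a b, Cmod (a - c) < R -> Cmod (b - c) < R -> cont_along f a b).
  { intros a b Ha Hb t Ht. apply Hcf. now apply seg_ball. }
  destruct (proj1 (continuous_C_iff f z) (Hcf z Hz) eps He) as [d [Hd H1]].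
  exists (Rmin d (R - Cmod (z - c))). split; [apply Rmin_pos; lra|].
  intros w Hw. assert (Hw1 := Rlt_le_trans _ _ _ Hw (Rmin_l _ _)). assert (Hw2 := Rlt_le_trans _ _ _ Hw (Rmin_r _ _)).
  assert (HwR : Cmod (w - c) < R).
  { replace (w - c)%C with ((w - z) + (z - c))%C by ring. eapply Rle_lt_trans; [apply Cmod_triangle|]. lra. }
  assert (T := goursat f c R Hf c z w HR Hz HwR). unfold tri_int in T.
  rewrite (seg_int_swap f c w) in T by auto.
  assert (E : (seg_int f c w - seg_int f c z = seg_int f z w)%C).
  { transitivity (seg_int f c w - seg_int f c z + (seg_int f c z + seg_int f z w + - seg_int f c w))%C; [rewrite T; ring|ring]. }
  rewrite E, <- seg_int_const, <- seg_int_minus; auto.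
  2: { intros t Ht. ccont. }
  apply seg_int_bound.
  - intros t Ht. ccont. apply Hca; auto.
  - intros t Ht. apply Rlt_le, H1. apply seg_ball; auto.
    replace (z - z)%C with (RtoC 0) by ring. now rewrite Cmod_0.
Qed.

(** * Cauchy's formula on circles *)

Definition smooth_path (g dg : R -> C) : Prop :=
  (forall t, @is_derive R_AbsRing C_R_NormedModule g t (dg t)) /\
  (forall t, @continuous R_UniformSpace CU dg t).

Lemma smooth_path_cont g dg t : smooth_path g dg -> @continuous R_UniformSpace CU g t.
Proof. intros [H _]. eapply path_deriv_continuous, H. Qed.

Lemma continuity_pt_Cmod f t : @continuous R_UniformSpace CU f t -> continuity_pt (fun s => Cmod (f s)) t.
Proof.
  intros H. apply continuity_pt_filterlim, (filterlim_locally (U := R_UniformSpace)). intros eps.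
  destruct (proj1 (continuous_path_iff f t) H eps (cond_pos eps)) as [d [Hd H1]].
  exists (mkposreal d Hd). intros s Hs. specialize (H1 s Hs).
  change (Rabs (Cmod (f s) - Cmod (f t)) < eps).
  assert (K1 := Cmod_triangle_rev (f s) (f t)). assert (K2 := Cmod_triangle_rev (f t) (f s)).
  rewrite Cmod_minus_sym in K2. apply Rabs_def1; lra.
Qed.

Lemma path_bounded f a b : a <= b -> path_continuous_on f a b ->
  exists M, 0 < M /\ forall t, a <= t <= b -> Cmod (f t) <= M.
Proof.
  intros Hab H. destruct (continuity_ab_maj (fun s => Cmod (f s)) a b Hab) as [m [Hm _]].
  { intros c Hc. apply continuity_pt_Cmod. now apply H. }
  exists (Cmod (f m) + 1). split; [assert (K := Cmod_ge_0 (f m)); lra|].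
  intros t Ht. specialize (Hm t Ht). simpl in Hm. lra.
Qed.

Lemma path_away_from_zero f a b : a <= b -> path_continuous_on f a b -> (forall t, a <= t <= b -> f t <> RtoC 0) ->
  exists d, 0 < d /\ forall t, a <= t <= b -> d <= Cmod (f t).
Proof.
  intros Hab H H0. destruct (continuity_ab_min (fun s => Cmod (f s)) a b Hab) as [m [Hm Hm']].
  { intros c Hc. apply continuity_pt_Cmod. now apply H. }
  exists (Cmod (f m)). split; [apply Cmod_gt_0; now apply H0|exact Hm].
Qed.

(** Uniform continuity near the compact image of a path, also at points off
    the path. *)
Lemma uniform_along (p : C -> C) (w : R -> C) (a b eps : R) : 0 < eps ->
  path_continuous_on w a b -> (forall t, a <= t <= b -> @continuous CU CU p (w t)) ->
  exists d, 0 < d /\ forall t u, a <= t <= b -> Cmod (u - w t) < d -> Cmod (p u - p (w t)) < eps.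
Proof.
  intros He Hw Hp.
  assert (Hd : forall t, exists d : posreal, a <= t <= b -> forall s u, Rabs (s - t) < d -> Cmod (u - w s) < d ->
     Cmod (p u - p (w s)) < eps).
  { intros t. destruct (classic (a <= t <= b)) as [Ht|Ht]; [|exists (mkposreal 1 Rlt_0_1); tauto].
    destruct (proj1 (continuous_C_iff p (w t)) (Hp t Ht) (eps/2)) as [d1 [Hd1 H1]]; [lra|].
    destruct (proj1 (continuous_path_iff w t) (Hw t Ht) (d1/2)) as [d2 [Hd2 H2]]; [lra|].
    exists (mkposreal (Rmin (d1/2) d2) ltac:(apply Rmin_pos; lra)). simpl. intros _ s u Hs Hu.
    assert (Hs' := Rlt_le_trans _ _ _ Hs (Rmin_r _ _)). assert (Hu' := Rlt_le_trans _ _ _ Hu (Rmin_l _ _)).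
    specialize (H2 s Hs').
    replace (p u - p (w s))%C with ((p u - p (w t)) - (p (w s) - p (w t)))%C by ring.
    eapply Rle_lt_trans; [apply Cmod_triangle|]. rewrite Cmod_opp.
    assert (Cmod (p u - p (w t)) < eps/2).
    { apply H1. replace (u - w t)%C with ((u - w s) + (w s - w t))%C by ring.
      eapply Rle_lt_trans; [apply Cmod_triangle|]. lra. }
    assert (Cmod (p (w s) - p (w t)) < eps/2) by (apply H1; lra). lra. }
  set (delta := fun t => proj1_sig (constructive_indefinite_description _ (Hd t))).
  destruct (compactness_value_1d a b delta) as [d H]. exists d; split; [apply cond_pos|].
  intros t u Ht Hu. apply NNPP. intros Hn. apply (H t Ht). intros [s [Hs [Hst Hds]]]. apply Hn.
  assert (K := proj2_sig (constructive_indefinite_description _ (Hd s)) Hs). fold (delta s) in K.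
  apply K; [exact Hst|exact (Rlt_le_trans _ _ _ Hu Hds)].
Qed.

(** The derivative has to vanish only along the segment, which is how locally
    constant functions are compared below. *)
Lemma holo_deriv_zero_const F p q : (forall t, 0 <= t <= 1 -> holo_deriv F (seg p q t) 0) -> F q = F p.
Proof.
  intros H. assert (K := mean_value_bound F (fun _ => RtoC 0) p q 0 0 H).
  rewrite Rmult_0_l in K.
  assert (Hz : Cmod (F q - F p - 0 * (q - p)) <= 0).
  { apply K.
    - intros t _; ccont.
    - intros t _. replace (0 - 0)%C with (RtoC 0) by ring. rewrite Cmod_0; lra. }
  assert (E : (F q - F p - 0 * (q - p))%C = 0) by (apply Cmod_eq_0, Rle_antisym; [exact Hz|apply Cmod_ge_0]).
  apply Ceq_minus. rewrite <- E. ring.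
Qed.


(** Integrals of Cauchy type: the density [phi] against the [k]-th power of
    the Cauchy kernel along [g]. *)
Definition kernel_int (phi g : R -> C) (k : nat) (a b : R) (z : C) : C :=
  path_int (fun t => phi t * (/ (g t - z)) ^ k)%C a b.

(** The Taylor estimate for inverse powers, with [al] and [be] the inverses of
    [g - z - h] and [g - z]: their difference is [h] times their product, and
    the induction step is the identity al^(k+1) - be^(k+1) - (k+1) h be^(k+2)
    = al (al^k - be^k - k h be^(k+1)) + (k+1) h^2 al be^(k+2). *)
Lemma inverse_power_taylor k M : 0 <= M -> exists B, 0 <= B /\ forall al be h : C,
  Cmod al <= M -> Cmod be <= M -> (al - be)%C = (h * (al * be))%C ->
  Cmod (al ^ k - be ^ k - h * (RtoC (INR k) * be ^ S k)) <= B * Cmod h ^ 2.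
Proof.
  intros HM. induction k as [|k [B [HB IH]]].
  - exists 0; split; [lra|]. intros al be h _ _ _. simpl INR.
    replace (al ^ 0 - be ^ 0 - h * (0 * be ^ 1))%C with (RtoC 0) by (simpl; ring). rewrite Cmod_0; lra.
  - exists (M * B + INR (S k) * M ^ (S (S (S k)))). split.
    { apply Rplus_le_le_0_compat; [now apply Rmult_le_pos|]. apply Rmult_le_pos; [apply pos_INR|now apply pow_le]. }
    intros al be h Ha Hb E. specialize (IH al be h Ha Hb E).
    replace (al ^ S k - be ^ S k - h * (RtoC (INR (S k)) * be ^ S (S k)))%C with
      (al * (al ^ k - be ^ k - h * (RtoC (INR k) * be ^ S k)) + RtoC (INR (S k)) * (h * h) * (al * be ^ (S (S k))))%C.
    2: { rewrite S_INR, RtoC_plus, !Cpow_S. symmetry.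
         transitivity (al * (al ^ k - be ^ k - h * (RtoC (INR k) * (be * be ^ k))) + (RtoC (INR k) + 1) * (h * h) * (al * (be * (be * be ^ k)))
           + be ^ k * (al - be - h * (al * be)) * (1 + (RtoC (INR k) + 1) * h * be))%C; [ring|].
         rewrite E; ring. }
    eapply Rle_trans; [apply Cmod_triangle|]. rewrite !Cmod_mult, !Cmod_pow, Cmod_R, Rabs_pos_eq by apply pos_INR.
    rewrite Rmult_plus_distr_r. apply Rplus_le_compat.
    + rewrite Rmult_assoc. apply Rmult_le_compat; auto; apply Cmod_ge_0.
    + replace (INR (S k) * M ^ S (S (S k)) * Cmod h ^ 2) with (INR (S k) * (Cmod h * Cmod h) * (M * M ^ S (S k))) by (simpl; ring).
      apply Rmult_le_compat_l. { apply Rmult_le_pos; [apply pos_INR|apply Rmult_le_pos; apply Cmod_ge_0]. }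
      apply Rmult_le_compat; auto; try apply Cmod_ge_0. apply pow_le, Cmod_ge_0.
      apply pow_incr. split; [apply Cmod_ge_0|auto].
Qed.

Lemma ccont_pow (T : UniformSpace) (f : T -> C) k x : @continuous T CU f x -> @continuous T CU (fun t => (f t) ^ k)%C x.
Proof. intros H. induction k as [|k IH]; simpl; ccont. Qed.

Lemma kernel_continuous phi g k a b z : path_continuous_on phi a b -> path_continuous_on g a b ->
  (forall t, a <= t <= b -> g t <> z) -> path_continuous_on (fun t => phi t * (/ (g t - z)) ^ k)%C a b.
Proof.
  intros Hphi Hg H t Ht. specialize (Hphi t Ht). specialize (Hg t Ht).
  apply (ccont_mult _ phi); auto. apply (ccont_pow _ (fun t => / (g t - z))%C). ccont.
  apply Cminus_eq_contra. now apply H.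
Qed.

(** Differentiation under the integral sign, from the Taylor estimate for the
    integrand, which is uniform because the path stays away from [z]. *)
Lemma kernel_deriv phi g k a b z : a <= b -> path_continuous_on phi a b -> path_continuous_on g a b ->
  (forall t, a <= t <= b -> g t <> z) ->
  holo_deriv (kernel_int phi g k a b) z (RtoC (INR k) * kernel_int phi g (S k) a b z).
Proof.
  intros Hab Hphi Hg Hz.
  destruct (path_away_from_zero (fun t => g t - z)%C a b Hab) as [d [Hd H1]].
  { intros t Ht. specialize (Hg t Ht). ccont. }
  { intros t Ht. apply Cminus_eq_contra. now apply Hz. }
  cbv beta in H1.
  destruct (path_bounded phi a b Hab Hphi) as [Mp [HMp H2]].
  destruct (inverse_power_taylor k (2 / d)) as [B [HB H3]]. { apply Rlt_le, Rdiv_lt_0_compat; lra. }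
  intros eps He.
  set (Q := (b - a) * (Mp * B) + 1).
  assert (HQ0 : 0 <= (b - a) * (Mp * B)) by (repeat apply Rmult_le_pos; lra).
  exists (Rmin (d/2) (eps / Q)). split. { apply Rmin_pos; [lra|]. apply Rdiv_lt_0_compat; unfold Q; lra. }
  intros w Hw. set (h := (w - z)%C) in *.
  assert (Hh1 := Rlt_le_trans _ _ _ Hw (Rmin_l _ _)). assert (Hh2 := Rlt_le_trans _ _ _ Hw (Rmin_r _ _)).
  assert (Hgw : forall t, a <= t <= b -> d / 2 <= Cmod (g t - w)).
  { intros t Ht. specialize (H1 t Ht). replace (g t - w)%C with ((g t - z) - h)%C by (unfold h; ring).
    assert (K := Cmod_triangle_rev (g t - z) h). lra. }
  assert (Hw0 : forall t, a <= t <= b -> g t <> w).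
  { intros t Ht E. specialize (Hgw t Ht). rewrite E in Hgw. replace (w - w)%C with (RtoC 0) in Hgw by ring.
    rewrite Cmod_0 in Hgw; lra. }
  assert (C1 := kernel_continuous phi g k a b w Hphi Hg Hw0). assert (C2 := kernel_continuous phi g k a b z Hphi Hg Hz).
  assert (C3 := kernel_continuous phi g (S k) a b z Hphi Hg Hz).
  assert (E : (kernel_int phi g k a b w - kernel_int phi g k a b z - RtoC (INR k) * kernel_int phi g (S k) a b z * h)%C =
     path_int (fun t => (phi t * (/ (g t - w)) ^ k - phi t * (/ (g t - z)) ^ k) - (h * RtoC (INR k)) * (phi t * (/ (g t - z)) ^ S k))%C a b).
  { unfold kernel_int. rewrite path_int_minus, path_int_minus, path_int_scal; auto. ring.
    intros t Ht. specialize (C1 t Ht); specialize (C2 t Ht). cbv beta in *. ccont.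
    intros t Ht. specialize (C3 t Ht). cbv beta in *. ccont. }
  rewrite E.
  apply Rle_trans with ((b - a) * (Mp * (B * Cmod h ^ 2))).
  - apply path_int_bound; auto.
    { intros t Ht. specialize (C1 t Ht); specialize (C2 t Ht); specialize (C3 t Ht). cbv beta in *. ccont. }
    intros t Ht.
    replace (phi t * (/ (g t - w)) ^ k - phi t * (/ (g t - z)) ^ k - h * RtoC (INR k) * (phi t * (/ (g t - z)) ^ S k))%C
     with (phi t * ((/ (g t - w)) ^ k - (/ (g t - z)) ^ k - h * (RtoC (INR k) * (/ (g t - z)) ^ S k)))%C by ring.
    rewrite Cmod_mult. apply Rmult_le_compat; auto; try apply Cmod_ge_0.
    assert (Nz := Cminus_eq_contra _ _ (Hz t Ht)). assert (Nw := Cminus_eq_contra _ _ (Hw0 t Ht)).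
    assert (Hdz := H1 t Ht). assert (Hdw := Hgw t Ht).
    apply H3.
    + rewrite Cmod_inv by auto. replace (2 / d) with (/ (d / 2)) by (field; lra). apply Rinv_le_contravar; lra.
    + rewrite Cmod_inv by auto. replace (2 / d) with (/ (d / 2)) by (field; lra). apply Rinv_le_contravar; lra.
    + unfold h. field. split; auto.
  - replace ((b - a) * (Mp * (B * Cmod h ^ 2))) with ((b - a) * (Mp * B) * Cmod h * Cmod h) by ring.
    assert (K := Cmod_ge_0 h). apply Rmult_le_compat_r; auto.
    apply Rle_trans with (Q * (eps / Q)).
    + apply Rmult_le_compat; [exact HQ0|exact K|unfold Q; lra|lra].
    + right. field. unfold Q; lra.
Qed.

Lemma path_minus_derive g dg t z : smooth_path g dg ->
  @is_derive R_AbsRing C_R_NormedModule (fun s => g s - z)%C t (dg t).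
Proof.
  intros [H _]. replace (dg t) with ((1 - 0) * dg t)%C by ring.
  apply (path_deriv_comp (fun w => w - z)%C g); [|apply H].
  apply holo_deriv_minus; [apply holo_deriv_id|apply holo_deriv_const].
Qed.

(** The squared kernel has the primitive [- / (w - z)], so it integrates to
    zero along a closed path; this makes the index locally constant. *)
Lemma closed_kernel_2 g dg a b z : a <= b -> smooth_path g dg -> g a = g b ->
  (forall t, a <= t <= b -> g t <> z) -> kernel_int dg g 2 a b z = 0.
Proof.
  intros Hab Hs Hcl Hz. unfold kernel_int.
  rewrite (path_int_FTC (fun t => - / (g t - z))%C); auto.
  - rewrite Hcl. ring.
  - intros t Ht. assert (N := Cminus_eq_contra _ _ (Hz t Ht)).
    replace (dg t * (/ (g t - z)) ^ 2)%C with (- 1 * (- / ((g t - z) * (g t - z))) * dg t)%C.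
    2: { simpl. field. auto. }
    apply (path_deriv_comp (fun w => - / w)%C (fun s => g s - z)%C); [|now apply path_minus_derive].
    eapply holo_deriv_ext_loc with (f := fun w => (-1 * / w)%C) (r := 1); [lra| |].
    + intros w _. ring.
    + now apply holo_deriv_scal, holo_deriv_inv.
  - apply kernel_continuous; auto; intros t _; [apply Hs|eapply smooth_path_cont, Hs].
Qed.

Lemma index_deriv g dg a b z : a <= b -> smooth_path g dg -> g a = g b ->
  (forall t, a <= t <= b -> g t <> z) -> holo_deriv (kernel_int dg g 1 a b) z 0.
Proof.
  intros Hab Hs Hcl Hz. eapply holo_deriv_val.
  - apply kernel_deriv; auto; intros t _; [apply Hs|eapply smooth_path_cont, Hs].
  - rewrite (closed_kernel_2 g dg) by auto. ring.
Qed.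

Definition circle (c : C) (r : R) (t : R) : C := (c + RtoC r * (cos t, sin t))%C.
Definition dcircle (r : R) (t : R) : C := (RtoC r * ((- sin t)%R, cos t))%C.

Lemma is_derive_pair (x y : R -> R) t a b : is_derive x t a -> is_derive y t b ->
  @is_derive R_AbsRing C_R_NormedModule (fun s => (x s, y s) : C) t ((a, b) : C).
Proof.
  intros [_ Hx] [_ Hy]. apply is_derive_path_iff. intros eps He.
  destruct (Hx t (fun P HP => HP) (mkposreal (eps/2) ltac:(lra))) as [d1 H1].
  destruct (Hy t (fun P HP => HP) (mkposreal (eps/2) ltac:(lra))) as [d2 H2].
  exists (Rmin d1 d2). split; [apply Rmin_pos; apply cond_pos|]. intros s Hs.
  assert (K1 := H1 s (Rlt_le_trans _ _ _ Hs (Rmin_l _ _))). assert (K2 := H2 s (Rlt_le_trans _ _ _ Hs (Rmin_r _ _))).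
  change (Rabs (x s - x t - (s - t) * a) <= eps / 2 * Rabs (s - t)) in K1.
  change (Rabs (y s - y t - (s - t) * b) <= eps / 2 * Rabs (s - t)) in K2.
  eapply Rle_trans; [apply Cmod_le_sum|]. simpl.
  replace (x s + - x t + - (a * (s - t) - b * 0)) with (x s - x t - (s - t) * a) by ring.
  replace (y s + - y t + - (a * 0 + b * (s - t))) with (y s - y t - (s - t) * b) by ring. lra.
Qed.

Lemma is_derive_affine_path (g : R -> C) dg t c k : @is_derive R_AbsRing C_R_NormedModule g t dg ->
  @is_derive R_AbsRing C_R_NormedModule (fun s => c + k * g s)%C t (k * dg)%C.
Proof.
  intros H. apply (path_deriv_comp (fun w => c + k * w)%C g); auto.
  eapply holo_deriv_val; [apply holo_deriv_plus; [apply holo_deriv_const|apply holo_deriv_scal, holo_deriv_id]|ring].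
Qed.

Lemma circle_smooth c r : smooth_path (circle c r) (dcircle r).
Proof.
  split; intros t.
  - apply is_derive_affine_path. apply is_derive_pair.
    apply is_derive_Reals, derivable_pt_lim_cos. apply is_derive_Reals, derivable_pt_lim_sin.
  - unfold dcircle. ccont. eapply path_deriv_continuous.
    apply (is_derive_pair (fun t => - sin t) cos t (- cos t) (- sin t)).
    apply (is_derive_opp (V := R_NormedModule)). apply is_derive_Reals, derivable_pt_lim_sin.
    apply is_derive_Reals, derivable_pt_lim_cos.
Qed.

Lemma Cmod_unit t : Cmod (cos t, sin t) = 1.
Proof.
  unfold Cmod. simpl fst; simpl snd. replace (cos t ^ 2 + sin t ^ 2) with 1. apply sqrt_1.
  assert (H := sin2_cos2 t). unfold Rsqr in H. lra.
Qed.

Lemma circle_dist c r t : 0 < r -> Cmod (circle c r t - c) = r.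
Proof.
  intros Hr. unfold circle. replace (c + r * (cos t, sin t) - c)%C with (r * (cos t, sin t))%C by ring.
  rewrite Cmod_mult, Cmod_unit, Cmod_R, Rabs_pos_eq; lra.
Qed.

Lemma dcircle_eq c r t : dcircle r t = (Ci * (circle c r t - c))%C.
Proof.
  unfold dcircle, circle. replace (c + r * (cos t, sin t) - c)%C with (r * (cos t, sin t))%C by ring.
  unfold Ci, RtoC, Cmult; simpl. f_equal; ring.
Qed.

Lemma dcircle_mod r t : 0 < r -> Cmod (dcircle r t) = r.
Proof. intros Hr. rewrite (dcircle_eq 0), Cmod_mult, Cmod_Ci, circle_dist; lra. Qed.

Lemma circle_closed c r : circle c r 0 = circle c r (2 * PI).
Proof. unfold circle. now rewrite cos_0, sin_0, cos_2PI, sin_2PI. Qed.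

Lemma circle_avoids c r z t : 0 < r -> Cmod (z - c) < r -> circle c r t <> z.
Proof. intros Hr Hz E. rewrite <- E, circle_dist in Hz; lra. Qed.

Lemma two_PI_pos : 0 <= 2 * PI.
Proof. assert (H := PI_RGT_0). lra. Qed.
#[local] Hint Resolve two_PI_pos : core.

Lemma path_int_const c a b : a <= b -> path_int (fun _ => c) a b = (RtoC (b - a) * c)%C.
Proof.
  intros Hab. unfold path_int. rewrite (@RInt_const C_R_CompleteNormedModule). apply scal_R_Cmult.
Qed.

(** At the centre the integrand is the constant [Ci]; the index does not
    change along the segment from the centre to [z]. *)
Lemma circle_index c r z : 0 < r -> Cmod (z - c) < r ->
  kernel_int (dcircle r) (circle c r) 1 0 (2 * PI) z = two_pi_i.
Proof.
  intros Hr Hz.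
  rewrite (holo_deriv_zero_const (kernel_int (dcircle r) (circle c r) 1 0 (2 * PI)) c z).
  - unfold kernel_int. transitivity (path_int (fun _ => Ci) 0 (2 * PI)).
    + apply path_int_ext; [auto|]. intros t _. rewrite (dcircle_eq c). rewrite Cpow_1_r. field.
      apply Cmod_nz. rewrite circle_dist; auto.
    + rewrite path_int_const by auto. unfold two_pi_i. now rewrite Rminus_0_r.
  - intros t Ht. apply index_deriv; auto. apply circle_smooth. apply circle_closed.
    intros s _. apply circle_avoids; auto. apply seg_ball; auto.
    replace (c - c)%C with (RtoC 0) by ring. now rewrite Cmod_0.
Qed.

Lemma two_pi_i_nz : two_pi_i <> RtoC 0.
Proof.
  apply Cmod_nz. unfold two_pi_i. rewrite Cmod_mult, Cmod_Ci, Cmod_R, Rabs_pos_eq by auto.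
  assert (H := PI_RGT_0). lra.
Qed.

Lemma path_derive_zero_const phi : (forall t, 0 <= t <= 1 -> @is_derive R_AbsRing C_R_NormedModule phi t (RtoC 0)) -> phi 1 = phi 0.
Proof.
  intros H. assert (K := path_int_FTC phi (fun _ => RtoC 0) 0 1 Rle_0_1 H).
  rewrite path_int_const in K by lra.
  assert (E : (phi 1 - phi 0)%C = 0). { rewrite <- K; [ring|]. intros t _. ccont. }
  now apply Ceq_minus.
Qed.

(** Contract the circle to [z] along rays: with w = z + la (zeta - z), the
    integral of P(w) / (zeta - z) over the circle does not depend on [la],
    since its derivative in [la] is the integral of [P'] along a closed loop.
    It is Cauchy's integral at [la = 1] and [P z] times the index at [la = 0].
    Continuity of the derivative [p] is needed to differentiate under the
    integral. *)
Theorem cauchy_formula P p c R r z :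
  (forall w, Cmod (w - c) < R -> holo_deriv P w (p w)) ->
  (forall w, Cmod (w - c) < R -> @continuous CU CU p w) ->
  0 < r < R -> Cmod (z - c) < r ->
  kernel_int (fun t => P (circle c r t) * dcircle r t)%C (circle c r) 1 0 (2 * PI) z = (two_pi_i * P z)%C.
Proof.
  intros HP Hp Hr Hz.
  set (zt := circle c r). set (dzt := dcircle r).
  assert (Hsm : smooth_path zt dzt) by apply circle_smooth.
  assert (Hne : forall t, zt t <> z) by (intros t; apply circle_avoids; lra).
  assert (Czt : forall t, @continuous R_UniformSpace CU zt t) by (intros t; eapply smooth_path_cont, Hsm).
  assert (Cdzt : forall t, @continuous R_UniformSpace CU dzt t) by apply Hsm.
  assert (Hseg : forall la t, 0 <= la <= 1 -> Cmod (seg z (zt t) la - c) <= r).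
  { intros la t Hla. apply seg_closed_ball; auto; [lra|]. unfold zt. rewrite circle_dist; lra. }
  assert (CP : forall w, Cmod (w - c) < R -> @continuous CU CU P w).
  { intros w Hw. eapply holo_deriv_continuous; eauto. }
  set (phi := fun la => path_int (fun t => P (seg z (zt t) la) * (dzt t * / (zt t - z)))%C 0 (2 * PI)).
  assert (E1 : phi 1 = kernel_int (fun t => P (zt t) * dzt t)%C zt 1 0 (2 * PI) z).
  { unfold phi, kernel_int. apply path_int_ext; [auto|]. intros t _. rewrite Cpow_1_r. unfold seg.
    replace (z + 1 * (zt t - z))%C with (zt t) by ring. ring. }
  assert (E0 : phi 0 = (two_pi_i * P z)%C).
  { rewrite <- (circle_index c r z) by lra. fold zt dzt. rewrite Cmult_comm. unfold kernel_int. rewrite <- path_int_scal; [|auto|].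
    - apply path_int_ext; [auto|]. intros t _. unfold seg. replace (z + 0 * (zt t - z))%C with z by ring. now rewrite Cpow_1_r.
    - apply kernel_continuous; auto; intros t _; auto. }
  rewrite <- E1, <- E0. clear E1 E0.
  apply path_derive_zero_const. intros la Hla. apply is_derive_path_iff. intros eps He.
  (* Formal differentiation in [la] gives the integral of [p] along the circle
     contracted by [la], where [p] has the primitive [P]. *)
  assert (Hloop : path_int (fun t => p (seg z (zt t) la) * dzt t)%C 0 (2 * PI) = 0).
  { destruct (Req_dec la 0) as [->|Hla0].
    - transitivity (path_int (fun t => p z * dzt t)%C 0 (2 * PI)).
      { apply path_int_ext; [auto|]. intros t _. unfold seg. now replace (z + 0 * (zt t - z))%C with z by ring. }
      rewrite path_int_scal; [|auto|intros t _; auto].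
      rewrite (path_int_FTC zt dzt); auto. unfold zt; rewrite <- circle_closed; ring.
      intros t _; apply Hsm. intros t _; auto.
    - assert (Hlc : RtoC la <> RtoC 0) by (intros E; apply Hla0; now apply RtoC_inj).
      rewrite (path_int_FTC (fun t => / RtoC la * P (seg z (zt t) la))%C); auto.
      + unfold zt; rewrite <- circle_closed; ring.
      + intros t _. replace (p (seg z (zt t) la) * dzt t)%C with (/ RtoC la * p (seg z (zt t) la) * (RtoC la * dzt t))%C by (field; auto).
        apply (path_deriv_comp (fun w => / RtoC la * P w)%C (fun s => seg z (zt s) la)).
        * apply holo_deriv_scal. apply HP. specialize (Hseg la t Hla). lra.
        * unfold seg. apply is_derive_path_iff. intros e Hee.
          destruct (proj1 (is_derive_path_iff _ _ _) (is_derive_affine_path zt (dzt t) t (z - RtoC la * z) (RtoC la) (proj1 Hsm t)) e Hee) as [d [Hd H]].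
          exists d; split; auto. intros s Hs.
          replace (z + la * (zt s - z) - (z + la * (zt t - z)))%C with (z - la * z + la * zt s - (z - la * z + la * zt t))%C by ring. auto.
      + intros t _. ccont; [|apply Cdzt]. apply (ccont_comp _ p (fun t => seg z (zt t) la)).
        unfold seg; ccont; apply Czt. apply Hp. specialize (Hseg la t Hla). lra. }
  set (ep := eps / (2 * PI * r + 1)).
  assert (HPI := PI_RGT_0). assert (HPr : 0 < 2 * PI * r) by (apply Rmult_lt_0_compat; lra).
  assert (Hep : 0 < ep) by (apply Rdiv_lt_0_compat; lra).
  destruct (uniform_along p (fun t => seg z (zt t) la) 0 (2 * PI) ep Hep) as [d [Hd Hu]].
  { intros t _. unfold seg; ccont; apply Czt. }
  { intros t _. apply Hp. specialize (Hseg la t Hla). lra. }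
  (* As [zt t - z] has modulus less than [2 * r], such a step in [la] moves the
     contracted circle by less than [d] and keeps it inside the ball. *)
  exists (Rmin d (R - r) / (2 * r)).
  assert (Hmin : 0 < Rmin d (R - r)) by (apply Rmin_pos; lra).
  split. { apply Rdiv_lt_0_compat; lra. }
  intros mu Hmu. set (k := mu - la) in *.
  assert (Hv : forall t, Rabs k * Cmod (zt t - z) < Rmin d (R - r)).
  { intros t. assert (Hv : Cmod (zt t - z) <= 2 * r).
    { replace (zt t - z)%C with ((zt t - c) - (z - c))%C by ring. eapply Rle_trans; [apply Cmod_triangle|].
      rewrite Cmod_opp. unfold zt; rewrite circle_dist; lra. }
    apply Rle_lt_trans with (Rabs k * (2 * r)). apply Rmult_le_compat_l; [apply Rabs_pos|auto].
    replace (Rmin d (R - r)) with (Rmin d (R - r) / (2 * r) * (2 * r)) by (field; lra).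
    apply Rmult_lt_compat_r; lra. }
  assert (Esh : forall t, seg z (zt t) mu = (seg z (zt t) la + RtoC k * (zt t - z))%C).
  { intros t. unfold seg, k. rewrite RtoC_minus. ring. }
  assert (Hnear : forall t s, 0 <= s <= 1 -> Cmod (seg (seg z (zt t) la) (seg z (zt t) mu) s - seg z (zt t) la) < Rmin d (R - r)).
  { intros t s Hs. rewrite Esh. unfold seg at 1.
    replace (seg z (zt t) la + s * (seg z (zt t) la + k * (zt t - z) - seg z (zt t) la) - seg z (zt t) la)%C with (RtoC s * (RtoC k * (zt t - z)))%C by ring.
    rewrite !Cmod_mult, !Cmod_R, (Rabs_pos_eq s) by lra. specialize (Hv t).
    assert (0 <= Rabs k * Cmod (zt t - z)) by (apply Rmult_le_pos; [apply Rabs_pos|apply Cmod_ge_0]).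
    apply Rle_lt_trans with (1 * (Rabs k * Cmod (zt t - z))); [apply Rmult_le_compat_r; lra|lra]. }
  assert (Hin : forall t s, 0 <= s <= 1 -> Cmod (seg (seg z (zt t) la) (seg z (zt t) mu) s - c) < R).
  { intros t s Hs. replace (seg (seg z (zt t) la) (seg z (zt t) mu) s - c)%C with
      ((seg (seg z (zt t) la) (seg z (zt t) mu) s - seg z (zt t) la) + (seg z (zt t) la - c))%C by ring.
    eapply Rle_lt_trans; [apply Cmod_triangle|]. specialize (Hnear t s Hs). specialize (Hseg la t Hla).
    assert (K := Rmin_r d (R - r)). lra. }
  assert (Hest : forall t, Cmod (P (seg z (zt t) mu) - P (seg z (zt t) la) - p (seg z (zt t) la) * (RtoC k * (zt t - z))) <= ep * (Rabs k * Cmod (zt t - z)) \/ ~ (0 <= t <= 2 * PI)).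
  { intros t. destruct (classic (0 <= t <= 2 * PI)) as [Ht|Ht]; [left|now right].
    replace (RtoC k * (zt t - z))%C with (seg z (zt t) mu - seg z (zt t) la)%C by (rewrite Esh; ring).
    replace (Rabs k * Cmod (zt t - z)) with (Cmod (seg z (zt t) mu - seg z (zt t) la)).
    2: { rewrite <- Cmod_R, <- Cmod_mult. f_equal. rewrite Esh; ring. }
    apply (mean_value_bound P p).
    - intros s Hs. apply HP. auto.
    - intros s Hs. apply Hp. auto.
    - intros s Hs. apply Rlt_le, (Hu t); auto. eapply Rlt_le_trans; [apply Hnear; auto|apply Rmin_l]. }
  assert (Hz0 : Cmod (seg z (zt 0) mu - c) < R).
  { replace (seg z (zt 0) mu) with (seg (seg z (zt 0) la) (seg z (zt 0) mu) 1); [apply Hin; lra|]. unfold seg; ring. }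
  assert (Hmu1 : forall t, Cmod (seg z (zt t) mu - c) < R).
  { intros t. replace (seg z (zt t) mu) with (seg (seg z (zt t) la) (seg z (zt t) mu) 1); [apply Hin; lra|]. unfold seg; ring. }
  assert (Cm : forall t, @continuous R_UniformSpace CU (fun t => P (seg z (zt t) mu)) t).
  { intros t. apply (ccont_comp _ P (fun t => seg z (zt t) mu)); [|apply CP, Hmu1]. unfold seg; ccont; apply Czt. }
  assert (Cl : forall t, @continuous R_UniformSpace CU (fun t => P (seg z (zt t) la)) t).
  { intros t. apply (ccont_comp _ P (fun t => seg z (zt t) la)). unfold seg; ccont; apply Czt.
    apply CP. specialize (Hseg la t Hla). lra. }
  assert (Cp : forall t, @continuous R_UniformSpace CU (fun t => p (seg z (zt t) la)) t).
  { intros t. apply (ccont_comp _ p (fun t => seg z (zt t) la)). unfold seg; ccont; apply Czt.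
    apply Hp. specialize (Hseg la t Hla). lra. }
  assert (Ck : forall t, @continuous R_UniformSpace CU (fun t => dzt t * / (zt t - z))%C t).
  { intros t. ccont; [apply Cdzt| |apply Czt]. apply Cminus_eq_contra, Hne. }
  replace (phi mu - phi la - 0 * RtoC k)%C with
    (path_int (fun t => (P (seg z (zt t) mu) - P (seg z (zt t) la) - p (seg z (zt t) la) * (RtoC k * (zt t - z))) * (dzt t * / (zt t - z)))%C 0 (2 * PI)).
  - apply Rle_trans with ((2 * PI - 0) * (ep * Rabs k * r)).
    + apply path_int_bound; auto.
      * intros t _. specialize (Cm t). specialize (Cl t). specialize (Cp t). specialize (Ck t).
        apply (ccont_mult _ (fun t => P (seg z (zt t) mu) - P (seg z (zt t) la) - p (seg z (zt t) la) * (RtoC k * (zt t - z)))%C (fun t => dzt t * / (zt t - z))%C); auto.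
        ccont. apply Czt.
      * intros t Ht. destruct (Hest t) as [H|H]; [|tauto].
        assert (N := Cminus_eq_contra _ _ (Hne t)). assert (N' := proj1 (Cmod_gt_0 _) N).
        rewrite !Cmod_mult, Cmod_inv by auto. unfold dzt at 1. rewrite dcircle_mod by lra.
        apply Rle_trans with (ep * (Rabs k * Cmod (zt t - z)) * (r * / Cmod (zt t - z))).
        apply Rmult_le_compat_r; auto. apply Rmult_le_pos; [lra|apply Rlt_le, Rinv_0_lt_compat; auto].
        right; field; lra.
    + replace ((2 * PI - 0) * (ep * Rabs k * r)) with (ep * (2 * PI * r) * Rabs k) by ring.
      apply Rmult_le_compat_r; [apply Rabs_pos|]. unfold ep.
      apply Rmult_le_reg_r with (2 * PI * r + 1); [lra|].
      replace (eps / (2 * PI * r + 1) * (2 * PI * r) * (2 * PI * r + 1)) with (eps * (2 * PI * r)) by (field; lra).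
      apply Rmult_le_compat_l; lra.
  - transitivity (path_int (fun t => (P (seg z (zt t) mu) * (dzt t * / (zt t - z)) - P (seg z (zt t) la) * (dzt t * / (zt t - z))) - RtoC k * (p (seg z (zt t) la) * dzt t))%C 0 (2 * PI)).
    + apply path_int_ext; [auto|]. intros t _. assert (N := Cminus_eq_contra _ _ (Hne t)). field. auto.
    + assert (I1 : path_continuous_on (fun t => P (seg z (zt t) mu) * (dzt t * / (zt t - z)))%C 0 (2*PI)).
      { intros t _. apply (ccont_mult _ (fun t => P (seg z (zt t) mu)) (fun t => dzt t * / (zt t - z))%C); auto. }
      assert (I2 : path_continuous_on (fun t => P (seg z (zt t) la) * (dzt t * / (zt t - z)))%C 0 (2*PI)).
      { intros t _. apply (ccont_mult _ (fun t => P (seg z (zt t) la)) (fun t => dzt t * / (zt t - z))%C); auto. }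
      assert (I3 : path_continuous_on (fun t => p (seg z (zt t) la) * dzt t)%C 0 (2*PI)).
      { intros t _. apply (ccont_mult _ (fun t => p (seg z (zt t) la)) dzt); auto. }
      rewrite path_int_minus; auto.
      * rewrite path_int_minus, path_int_scal, Hloop; auto. unfold phi. ring.
      * intros t Ht. apply (ccont_minus _ _ _ _ (I1 t Ht) (I2 t Ht)).
      * intros t Ht. apply (ccont_mult _ _ _ _ (ccont_const _ _ _) (I3 t Ht)).
Qed.

Lemma holo_deriv_unique f z a b : holo_deriv f z a -> holo_deriv f z b -> a = b.
Proof.
  intros Ha Hb. transitivity (C_derive f z); [symmetry|]; apply is_C_derive_unique; now apply is_derive_holo_deriv.
Qed.

(** A local primitive [P] of [f] is continuously differentiable, so Cauchy's
    formula represents it by kernel integrals, which can be differentiated any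
    number of times; [C_derive f] is the second derivative of [P]. *)
Theorem holomorphic_derivative f c R : 0 < R -> (forall z, Cmod (z - c) < R -> exists l, holo_deriv f z l) ->
  exists l, holo_deriv (C_derive f) c l.
Proof.
  intros HR Hf. destruct (primitive_ball f c R Hf) as [P HP].
  assert (Hfc : forall z, Cmod (z - c) < R -> @continuous CU CU f z).
  { intros z Hz. destruct (Hf z Hz) as [l Hl]. eapply holo_deriv_continuous; eauto. }
  set (r := R / 2). assert (Hr : 0 < r < R) by (unfold r; lra).
  set (phi := fun t => (P (circle c r t) * dcircle r t)%C).
  set (K := fun k => kernel_int phi (circle c r) k 0 (2 * PI)).
  assert (Cphi : path_continuous_on phi 0 (2 * PI)).
  { intros t _. unfold phi. ccont; [|apply (circle_smooth c)]. apply (ccont_comp _ P (circle c r)).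
    eapply smooth_path_cont, circle_smooth. eapply holo_deriv_continuous, HP. rewrite circle_dist; lra. }
  assert (DK : forall k z, Cmod (z - c) < r -> holo_deriv (K k) z (RtoC (INR k) * K (S k) z)).
  { intros k z Hz. apply kernel_deriv; [auto|auto| |]. intros t _; eapply smooth_path_cont, circle_smooth.
    intros t _. apply circle_avoids; lra. }
  assert (E0 : forall z, Cmod (z - c) < r -> (/ two_pi_i * K 1%nat z)%C = P z).
  { intros z Hz. unfold K, phi. rewrite (cauchy_formula P f c R r z); auto. field. apply two_pi_i_nz. }
  assert (shrink : forall z w, Cmod (z - c) < r -> Cmod (w - z) < r - Cmod (z - c) -> Cmod (w - c) < r).
  { intros z w Hz Hw. replace (w - c)%C with ((w - z) + (z - c))%C by ring.
    eapply Rle_lt_trans; [apply Cmod_triangle|]. lra. }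
  assert (E1 : forall z, Cmod (z - c) < r -> (/ two_pi_i * (RtoC (INR 1) * K 2%nat z))%C = f z).
  { intros z Hz. apply (holo_deriv_unique P z).
    - apply (holo_deriv_ext_loc (fun w => / two_pi_i * K 1%nat w)%C P z _ (r - Cmod (z - c))); [lra| |].
      intros w Hw; apply E0; apply (shrink z); auto. now apply holo_deriv_scal, DK.
    - apply HP. lra. }
  assert (E2 : forall z, Cmod (z - c) < r -> (/ two_pi_i * (RtoC (INR 1) * (RtoC (INR 2) * K 3%nat z)))%C = C_derive f z).
  { intros z Hz. symmetry. apply is_C_derive_unique, is_derive_holo_deriv.
    apply (holo_deriv_ext_loc (fun w => / two_pi_i * (RtoC (INR 1) * K 2%nat w))%C f z _ (r - Cmod (z - c))); [lra| |].
    intros w Hw; apply E1; apply (shrink z); auto. now apply holo_deriv_scal, holo_deriv_scal, DK. }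
  assert (Hcc : Cmod (c - c) < r) by (replace (c - c)%C with (RtoC 0) by ring; rewrite Cmod_0; lra).
  eexists. apply (holo_deriv_ext_loc (fun w => / two_pi_i * (RtoC (INR 1) * (RtoC (INR 2) * K 3%nat w)))%C _ c _ r); [lra|auto|].
  now apply holo_deriv_scal, holo_deriv_scal, holo_deriv_scal, DK.
Qed.

(** * Difference quotients and behaviour at infinity *)

Definition holomorphic (U : C -> Prop) (f : C -> C) : Prop := forall z, U z -> exists l, holo_deriv f z l.

Lemma Cmod_self (z : C) : Cmod (z - z) = 0.
Proof. replace (z - z)%C with (RtoC 0) by ring. apply Cmod_0. Qed.

Lemma holomorphic_deriv_at U f z : holomorphic U f -> U z -> holo_deriv f z (C_derive f z).
Proof. intros H Hz. apply C_derive_spec. now apply H. Qed.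

Lemma holomorphic_continuous U f z : holomorphic U f -> U z -> @continuous CU CU f z.
Proof. intros H Hz. destruct (H z Hz) as [l Hl]. eapply holo_deriv_continuous; eauto. Qed.

Lemma holomorphic_C_derive U f : open_C U -> holomorphic U f -> holomorphic U (C_derive f).
Proof.
  intros HU Hf z Hz. destruct (proj1 (open_C_iff U) HU z Hz) as [r [Hr H1]].
  apply (holomorphic_derivative f z r Hr). intros w Hw. auto.
Qed.

(** The difference quotient of [f] at [p], completed at [p] itself by the
    derivative. *)
Definition slope (f : C -> C) (p w : C) : C :=
  if Ceq_dec w p then C_derive f p else ((f w - f p) / (w - p))%C.

Lemma slope_diag f p : slope f p p = C_derive f p.
Proof. unfold slope. destruct (Ceq_dec p p); tauto. Qed.

Lemma slope_off f p w : w <> p -> slope f p w = ((f w - f p) / (w - p))%C.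
Proof. unfold slope. destruct (Ceq_dec w p); tauto. Qed.

Lemma slope_spec f p w : f w = (f p + (w - p) * slope f p w)%C.
Proof.
  destruct (Ceq_dec w p) as [->|H]; [ring|]. rewrite slope_off by auto.
  field. now apply Cminus_eq_contra.
Qed.

(** The singularity at [p] is removable: by the mean value inequality, applied
    to [f] minus its Taylor polynomial of degree two, the quotient has
    derivative f''(p) / 2 there. *)
Lemma slope_holomorphic U f p : open_C U -> holomorphic U f -> U p -> holomorphic U (slope f p).
Proof.
  intros HU Hf Hp w Hw. destruct (Ceq_dec w p) as [->|Hne].
  - destruct (proj1 (open_C_iff U) HU p Hp) as [r [Hr H1]].
    destruct (holomorphic_C_derive U f HU Hf p Hp) as [l Hl].
    exists (l / 2)%C. intros eps He. destruct (Hl eps He) as [d [Hd H2]].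
    exists (Rmin d r). split; [now apply Rmin_pos|]. intros u Hu.
    assert (Hu1 := Rlt_le_trans _ _ _ Hu (Rmin_l _ _)). assert (Hu2 := Rlt_le_trans _ _ _ Hu (Rmin_r _ _)).
    destruct (Ceq_dec u p) as [->|Hup].
    { replace (slope f p p - slope f p p - l / 2 * (p - p))%C with (RtoC 0) by ring.
      rewrite Cmod_0, Cmod_self; lra. }
    assert (N := Cminus_eq_contra _ _ Hup). assert (N' := proj1 (Cmod_gt_0 _) N).
    rewrite slope_diag, slope_off by auto.
    set (G := fun v => (f v - (C_derive f p * v + l / 2 * ((v - p) * (v - p))))%C).
    replace ((f u - f p) / (u - p) - C_derive f p - l / 2 * (u - p))%C with ((G u - G p - 0 * (u - p)) / (u - p))%C
      by (unfold G; field; auto).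
    rewrite Cmod_div by auto. apply Rmult_le_reg_r with (Cmod (u - p)); auto.
    unfold Rdiv. rewrite Rmult_assoc, Rinv_l, Rmult_1_r by lra.
    assert (Hball : forall t, 0 <= t <= 1 -> U (seg p u t)).
    { intros t Ht. apply H1. apply seg_ball; auto. rewrite Cmod_self; auto. }
    apply (mean_value_bound G (fun v => C_derive f v - (C_derive f p + l * (v - p)))%C).
    + intros t Ht. unfold G. apply holo_deriv_minus; [now apply (holomorphic_deriv_at U), Hball|].
      assert (Hid : forall v, holo_deriv (fun v => (v - p)%C) v (1 - 0)%C) by (intros; apply holo_deriv_minus; [apply holo_deriv_id|apply holo_deriv_const]).
      eapply holo_deriv_val.
      * apply holo_deriv_plus; apply holo_deriv_scal; [apply holo_deriv_id|apply holo_deriv_mult; apply Hid].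
      * simpl. field.
    + intros t Ht. ccont. apply (holomorphic_continuous U); auto. now apply holomorphic_C_derive.
    + intros t Ht.
      assert (K : Cmod (seg p u t - p) <= Cmod (u - p)).
      { apply seg_closed_ball; auto. rewrite Cmod_self; lra. lra. }
      replace (C_derive f (seg p u t) - (C_derive f p + l * (seg p u t - p)) - 0)%C with
        (C_derive f (seg p u t) - C_derive f p - l * (seg p u t - p))%C by ring.
      eapply Rle_trans; [apply H2; lra|]. apply Rmult_le_compat_l; lra.
  - assert (N := Cminus_eq_contra _ _ Hne). assert (N' := proj1 (Cmod_gt_0 _) N).
    destruct (Hf w Hw) as [l Hl]. eexists.
    eapply (holo_deriv_ext_loc (fun v => (f v - f p) * / (v - p))%C); [exact N'| |].
    + intros v Hv. rewrite slope_off; [reflexivity|]. intros ->. rewrite Cmod_minus_sym in Hv. lra.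
    + apply holo_deriv_mult; [apply holo_deriv_minus; [exact Hl|apply holo_deriv_const]|].
      apply (holo_deriv_comp Cinv (fun v => v - p)%C); [now apply holo_deriv_inv|].
      apply holo_deriv_minus; [apply holo_deriv_id|apply holo_deriv_const].
Qed.

(** A local Lipschitz bound, jointly in both points, since the derivative is
    continuous. *)
Lemma slope_bounded U f p : open_C U -> holomorphic U f -> U p ->
  exists r M, 0 < r /\ 0 < M /\ (forall w, Cmod (w - p) < r -> U w) /\
    forall x y, Cmod (x - p) < r -> Cmod (y - p) < r -> Cmod (slope f x y) <= M.
Proof.
  intros HU Hf Hp. destruct (proj1 (open_C_iff U) HU p Hp) as [r [Hr H1]].
  assert (Hf1 := holomorphic_C_derive U f HU Hf).
  destruct (proj1 (continuous_C_iff _ _) (holomorphic_continuous U _ p Hf1 Hp) 1) as [d [Hd H2]]; [lra|].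
  set (M := Cmod (C_derive f p) + 1).
  assert (HM : forall w, Cmod (w - p) < d -> Cmod (C_derive f w) <= M).
  { intros w Hw. specialize (H2 w Hw). unfold M. assert (K := Cmod_triangle_rev (C_derive f w) (C_derive f p)). lra. }
  exists (Rmin r d), M. split; [now apply Rmin_pos|].
  split. { unfold M. assert (K := Cmod_ge_0 (C_derive f p)); lra. }
  assert (Hrr : forall w, Cmod (w - p) < Rmin r d -> U w).
  { intros w Hw. apply H1. eapply Rlt_le_trans; [exact Hw|apply Rmin_l]. }
  split; auto. intros x y Hx Hy.
  destruct (Ceq_dec y x) as [->|Hne].
  { rewrite slope_diag. apply HM. eapply Rlt_le_trans; [exact Hx|apply Rmin_r]. }
  assert (N := Cminus_eq_contra _ _ Hne). assert (N' := proj1 (Cmod_gt_0 _) N).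
  rewrite slope_off, Cmod_div by auto. apply Rmult_le_reg_r with (Cmod (y - x)); auto.
  unfold Rdiv. rewrite Rmult_assoc, Rinv_l, Rmult_1_r by lra.
  replace (f y - f x)%C with (f y - f x - 0 * (y - x))%C by ring.
  apply (mean_value_bound f (C_derive f)).
  - intros t Ht. apply (holomorphic_deriv_at U); auto. apply Hrr. now apply seg_ball.
  - intros t Ht. apply (holomorphic_continuous U); auto. apply Hrr. now apply seg_ball.
  - intros t Ht. replace (C_derive f (seg x y t) - 0)%C with (C_derive f (seg x y t)) by ring.
    apply HM. eapply Rlt_le_trans; [apply seg_ball; eauto|apply Rmin_r].
Qed.

(** Cauchy's formula at the centre is the mean value property. *)
Lemma max_on_circle U f c r M : open_C U -> holomorphic U f -> 0 < r -> (forall w, Cmod (w - c) < r + 1 -> U w) ->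
  (forall w, Cmod (w - c) = r -> Cmod (f w) <= M) -> Cmod (f c) <= M.
Proof.
  intros HU Hf Hr Hb HM.
  assert (E := cauchy_formula f (C_derive f) c (r + 1) r c).
  specialize (E ltac:(intros w Hw; apply (holomorphic_deriv_at U); auto)).
  specialize (E ltac:(intros w Hw; apply (holomorphic_continuous U); [now apply holomorphic_C_derive|auto])).
  specialize (E ltac:(lra) ltac:(rewrite Cmod_self; lra)).
  assert (HPI := PI_RGT_0).
  assert (HM0 : 0 <= M). { eapply Rle_trans; [apply Cmod_ge_0|apply (HM (circle c r 0))]. now apply circle_dist. }
  assert (K : Cmod (kernel_int (fun t => f (circle c r t) * dcircle r t)%C (circle c r) 1 0 (2 * PI) c) <= (2 * PI - 0) * M).
  { apply path_int_bound; [lra| |].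
    - apply kernel_continuous.
      + intros t _. ccont; [|apply (circle_smooth c)]. apply (ccont_comp _ f (circle c r)).
        eapply smooth_path_cont, circle_smooth. apply (holomorphic_continuous U); auto. apply Hb. rewrite circle_dist; lra.
      + intros t _. eapply smooth_path_cont, circle_smooth.
      + intros t _. apply circle_avoids; auto. now rewrite Cmod_self.
    - intros t Ht. assert (D := circle_dist c r t Hr).
      rewrite Cpow_1_r, !Cmod_mult, dcircle_mod, Cmod_inv by (try apply Cmod_nz; lra). rewrite D.
      replace (Cmod (f (circle c r t)) * r * / r) with (Cmod (f (circle c r t))) by (field; lra). auto. }
  rewrite E, Cmod_mult in K.
  replace (Cmod two_pi_i) with (2 * PI) in K.
  2: { unfold two_pi_i. rewrite Cmod_mult, Cmod_Ci, Cmod_R, Rabs_pos_eq; lra. }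
  apply Rmult_le_reg_l with (2 * PI); lra.
Qed.

Definition vanishes_at_infinity (h : C -> C) : Prop :=
  forall eps, 0 < eps -> exists R, forall z, R < Cmod z -> Cmod (h z) <= eps.

(** Liouville's theorem in the form needed here: the value at a point is
    bounded by the values on arbitrarily large circles. *)
Lemma entire_vanishing h : (forall z, exists l, holo_deriv h z l) -> vanishes_at_infinity h -> forall z, h z = 0.
Proof.
  intros Hh Hv z. apply Cmod_eq_0, Rle_antisym; [|apply Cmod_ge_0].
  apply le_epsilon. intros eps He. rewrite Rplus_0_l.
  destruct (Hv eps He) as [R HR].
  set (r := Rabs R + Cmod z + 1).
  assert (K1 := Rabs_pos R). assert (K2 := Cmod_ge_0 z). assert (K3 := Rle_abs R).
  apply (max_on_circle (fun _ => True) h z r).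
  - apply open_C_iff. intros; exists 1; split; [lra|auto].
  - intros w _; auto.
  - unfold r; lra.
  - auto.
  - intros w Hw. apply HR. assert (K := Cmod_triangle_rev (w - z) (- z)). rewrite Cmod_opp in K.
    replace (w - z - - z)%C with w in K by ring. unfold r in Hw; lra.
Qed.

(** Cauchy's estimate on circles of radius one, in the form of the maximum
    principle for the difference quotient. *)
Lemma vanishing_derive U f R0 : open_C U -> holomorphic U f -> (forall z, R0 < Cmod z -> U z) ->
  vanishes_at_infinity (fun z => z * f z)%C -> vanishes_at_infinity (fun z => z * C_derive f z)%C.
Proof.
  intros HU Hf HR0 Hv eps He.
  (* On the unit circle around [z] the modulus is at least half of that of [z],
     so the values of [f] contribute at most two thirds of [eps / Cmod z], and
     [f z] contributes the last third. *)
  destruct (Hv (eps / 3)) as [R HR]; [lra|].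
  exists (Rmax (R0 + 3) (Rmax (R + 1) 2)). intros z Hz.
  assert (Hz1 := Rle_lt_trans _ _ _ (Rmax_l _ _) Hz). assert (Hz2 := Rle_lt_trans _ _ _ (Rmax_r _ _) Hz).
  assert (Hz3 := Rle_lt_trans _ _ _ (Rmax_l _ _) Hz2). assert (Hz4 := Rle_lt_trans _ _ _ (Rmax_r _ _) Hz2).
  rewrite Cmod_mult. apply Rmult_le_reg_l with (/ Cmod z). apply Rinv_0_lt_compat; lra.
  rewrite <- Rmult_assoc, Rinv_l, Rmult_1_l by lra.
  assert (Hsmall : forall w, Cmod z - 1 <= Cmod w -> Cmod (f w) <= eps / 3 * / Cmod w).
  { intros w Hw. specialize (HR w ltac:(lra)). rewrite Cmod_mult in HR.
    apply Rmult_le_reg_l with (Cmod w); [lra|]. replace (Cmod w * (eps / 3 * / Cmod w)) with (eps / 3) by (field; lra). exact HR. }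
  assert (Uz : U z) by (apply HR0; lra).
  rewrite <- slope_diag. apply (max_on_circle U (slope f z) z 1); auto; [now apply slope_holomorphic|lra| |].
  { intros w Hw. apply HR0. assert (K := Cmod_triangle_rev z (z - w)). rewrite (Cmod_minus_sym w z) in Hw.
    replace (z - (z - w))%C with w in K by ring. lra. }
  intros w Hw.
  assert (Hwz : w <> z) by (intros ->; rewrite Cmod_self in Hw; lra).
  assert (Hww : Cmod z - 1 <= Cmod w).
  { assert (K := Cmod_triangle_rev z (z - w)). rewrite (Cmod_minus_sym w z) in Hw.
    replace (z - (z - w))%C with w in K by ring. lra. }
  rewrite slope_off, Cmod_div, Hw by (try apply Cminus_eq_contra; auto).
  unfold Rdiv. rewrite Rinv_1, Rmult_1_r.
  assert (A := Hsmall w Hww). assert (B := Hsmall z ltac:(lra)).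
  assert (D : / Cmod w <= 2 * / Cmod z).
  { replace (2 * / Cmod z) with (/ (Cmod z / 2)) by (field; lra). apply Rinv_le_contravar; lra. }
  apply Rle_trans with (Cmod (f w) + Cmod (f z)).
  { unfold Cminus. eapply Rle_trans; [apply Cmod_triangle|]. rewrite Cmod_opp. lra. }
  assert (eps / 3 * / Cmod w <= eps / 3 * (2 * / Cmod z)) by (apply Rmult_le_compat_l; lra). lra.
Qed.

(** * The winding number and the two domains *)

Section Curve.
Context (G : simple_closed_curve).
Let T := period G.

Lemma period_gt0 : 0 < T.
Proof. apply period_pos. Qed.

#[local] Hint Resolve period_gt0 : core.

Lemma period_ge0 : 0 <= T.
Proof. apply Rlt_le, period_gt0. Qed.

#[local] Hint Resolve period_ge0 : core.

Lemma curve_smooth : smooth_path (gamma G) (dgamma G).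
Proof.
  split; intros t; [apply gamma_deriv|]. apply continuous_CU_codomain, dgamma_cont.
Qed.

Lemma curve_cont t : @continuous R_UniformSpace CU (gamma G) t.
Proof. apply (smooth_path_cont _ _ t curve_smooth). Qed.

Lemma curve_closed : gamma G 0 = gamma G T.
Proof. rewrite <- (gamma_periodic G 0). f_equal. unfold T; lra. Qed.

Lemma dgamma_periodic t : dgamma G (t + T) = dgamma G t.
Proof.
  apply Ceq_minus, Cmod_eq_0, Rle_antisym; [|apply Cmod_ge_0].
  apply le_epsilon. intros eps He. rewrite Rplus_0_l.
  destruct (proj1 (is_derive_path_iff _ _ _) (gamma_deriv G t) (eps/2)) as [d1 [Hd1 H1]]; [lra|].
  destruct (proj1 (is_derive_path_iff _ _ _) (gamma_deriv G (t + T)) (eps/2)) as [d2 [Hd2 H2]]; [lra|].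
  set (k := Rmin d1 d2 / 2). assert (Hk : 0 < Rmin d1 d2) by now apply Rmin_pos.
  assert (K1 := Rmin_l d1 d2). assert (K2 := Rmin_r d1 d2).
  assert (Hk0 : 0 < k) by (unfold k; lra).
  specialize (H1 (t + k)). specialize (H2 (t + k + T)).
  replace (t + k - t) with k in H1 by ring. replace (t + k + T - (t + T)) with k in H2 by ring.
  rewrite Rabs_pos_eq in H1, H2 by lra.
  rewrite !(gamma_periodic G) in H2.
  specialize (H1 ltac:(unfold k; lra)). specialize (H2 ltac:(unfold k; lra)).
  apply Rmult_le_reg_r with k; auto.
  replace (Cmod (dgamma G (t + T) - dgamma G t) * k) with (Cmod ((dgamma G (t + T) - dgamma G t) * RtoC k))
    by (rewrite Cmod_mult, Cmod_R, (Rabs_pos_eq k); lra).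
  replace ((dgamma G (t + T) - dgamma G t) * RtoC k)%C with
   ((gamma G (t + k) - gamma G t - dgamma G t * RtoC k) - (gamma G (t + k) - gamma G t - dgamma G (t + T) * RtoC k))%C by ring.
  eapply Rle_trans; [apply Cmod_triangle|]. rewrite Cmod_opp. lra.
Qed.

Lemma gamma_shift_nat t n : gamma G (t + INR n * T) = gamma G t.
Proof.
  induction n as [|n IH]; [f_equal; simpl; ring|].
  rewrite <- IH, <- (gamma_periodic G (t + INR n * T)), S_INR. f_equal. fold T; ring.
Qed.

Lemma gamma_shift t (k : Z) : gamma G (t + IZR k * T) = gamma G t.
Proof.
  destruct (Z_le_gt_dec 0 k) as [H|H].
  - rewrite <- (Z2Nat.id k H), <- INR_IZR_INZ. apply gamma_shift_nat.
  - rewrite <- (gamma_shift_nat _ (Z.to_nat (- k))). f_equal.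
    rewrite INR_IZR_INZ, Z2Nat.id by lia. rewrite opp_IZR. ring.
Qed.

Lemma real_mod a t : exists (k : Z) s, t = s + IZR k * T /\ a <= s < a + T.
Proof.
  set (x := (t - a) / T). destruct (archimed x) as [H1 H2].
  assert (E : x * T = t - a) by (unfold x; field; assert (H := period_gt0); lra).
  exists (up x - 1)%Z, (t - IZR (up x - 1) * T). split; [ring|].
  rewrite minus_IZR.
  assert (K1 : (IZR (up x) - 1) * T <= x * T) by (apply Rmult_le_compat_r; [auto|lra]).
  assert (K2 : x * T < IZR (up x) * T) by (apply Rmult_lt_compat_r; [auto|lra]). lra.
Qed.

Lemma curve_window a t : exists s, a <= s < a + T /\ gamma G s = gamma G t.
Proof.
  destruct (real_mod a t) as [k [s [-> Hs]]]. exists s; split; auto. now rewrite gamma_shift.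
Qed.

(** Simplicity is given on one period only; here the parameters may lie in any
    window shorter than a period. *)
Lemma curve_injective s t : gamma G s = gamma G t -> Rabs (s - t) < T -> s = t.
Proof.
  intros E H. destruct (real_mod 0 s) as [k [s0 [-> Hs]]]. destruct (real_mod 0 t) as [m [t0 [-> Ht]]].
  rewrite !gamma_shift in E. assert (s0 = t0) as -> by (apply (gamma_simple G); auto; fold T; lra).
  replace (t0 + IZR k * T - (t0 + IZR m * T)) with (IZR (k - m) * T) in H by (rewrite minus_IZR; ring).
  rewrite Rabs_mult, (Rabs_pos_eq T), <- abs_IZR in H by auto.
  assert (Hlt : IZR (Z.abs (k - m)) < IZR 1).
  { apply Rmult_lt_reg_r with T; auto. lra. }
  apply lt_IZR in Hlt. assert (k = m) as -> by lia. reflexivity.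
Qed.

Lemma curve_bounded : exists M, 0 < M /\ forall t, Cmod (gamma G t) <= M.
Proof.
  destruct (path_bounded (gamma G) 0 T period_ge0) as [M [HM H]]. intros t _; apply curve_cont.
  exists M; split; auto. intros t. destruct (curve_window 0 t) as [s [Hs <-]]. apply H; lra.
Qed.

Lemma off_curve_ne z t : off_curve G z -> gamma G t <> z.
Proof. intros H E. apply H. now exists t. Qed.

Lemma off_curve_dist z : off_curve G z -> exists d, 0 < d /\ forall t, d <= Cmod (gamma G t - z).
Proof.
  intros Hz. destruct (path_away_from_zero (fun t => gamma G t - z)%C 0 T period_ge0) as [d [Hd H]].
  - intros t _. assert (H := curve_cont t). ccont.
  - intros t _. apply Cminus_eq_contra. now apply off_curve_ne.
  - exists d; split; auto. intros t. destruct (curve_window 0 t) as [s [Hs <-]]. apply H; lra.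
Qed.

Lemma off_curve_open z : off_curve G z -> exists d, 0 < d /\ forall w, Cmod (w - z) < d -> off_curve G w.
Proof.
  intros Hz. destruct (off_curve_dist z Hz) as [d [Hd H]]. exists d; split; auto.
  intros w Hw [t <-]. specialize (H t). lra.
Qed.

Definition index_integral : C -> C := kernel_int (dgamma G) (gamma G) 1 0 T.

Lemma winding_number_eq z : winding_number G z = (/ two_pi_i * index_integral z)%C.
Proof.
  unfold winding_number, contour_integral, contour_integrand. f_equal.
  apply path_int_ext; auto. intros t _. rewrite Cpow_1_r. apply Cmult_comm.
Qed.

Lemma index_integral_deriv z : off_curve G z -> holo_deriv index_integral z 0.
Proof.
  intros Hz. apply index_deriv; auto. apply curve_smooth. apply curve_closed.
  intros t _. now apply off_curve_ne.
Qed.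

Lemma winding_deriv z : off_curve G z -> holo_deriv (winding_number G) z 0.
Proof.
  intros Hz. apply (holo_deriv_ext_loc (fun w => / two_pi_i * index_integral w)%C _ z _ 1); [lra| |].
  - intros w _. now rewrite winding_number_eq.
  - eapply holo_deriv_val; [apply holo_deriv_scal, index_integral_deriv, Hz|ring].
Qed.

Lemma winding_locally_const z : off_curve G z -> exists d, 0 < d /\ forall w, Cmod (w - z) < d ->
  off_curve G w /\ winding_number G w = winding_number G z.
Proof.
  intros Hz. destruct (off_curve_open z Hz) as [d [Hd H]]. exists d; split; auto.
  intros w Hw. split; auto. apply holo_deriv_zero_const. intros t Ht. apply winding_deriv, H.
  apply seg_ball; auto. now rewrite Cmod_self.
Qed.

Lemma kernel_vanishes phi : path_continuous_on phi 0 T -> vanishes_at_infinity (kernel_int phi (gamma G) 1 0 T).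
Proof.
  intros Hphi eps He. destruct (path_bounded phi 0 T period_ge0 Hphi) as [L [HL H1]].
  destruct curve_bounded as [M [HM H2]]. assert (HT := period_gt0).
  assert (HTL : 0 < T * L) by now apply Rmult_lt_0_compat.
  assert (HQ : 0 < T * L / eps) by now apply Rdiv_lt_0_compat.
  exists (M + T * L / eps). intros z Hz.
  assert (D : forall t, T * L / eps <= Cmod (gamma G t - z)).
  { intros t. assert (K := Cmod_triangle_rev z (gamma G t)). rewrite Cmod_minus_sym in K. specialize (H2 t). lra. }
  assert (Hne : forall t, gamma G t <> z).
  { intros t E. specialize (D t). rewrite E, Cmod_self in D. lra. }
  apply Rle_trans with ((T - 0) * (L * (eps / (T * L)))).
  - apply path_int_bound; auto. apply kernel_continuous; auto. intros t _; apply curve_cont.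
    intros t Ht. assert (N := Cminus_eq_contra _ _ (Hne t)).
    rewrite Cpow_1_r, Cmod_mult, Cmod_inv by auto. apply Rmult_le_compat; auto. apply Cmod_ge_0.
    apply Rlt_le, Rinv_0_lt_compat. specialize (D t); lra.
    replace (eps / (T * L)) with (/ (T * L / eps)) by (field; repeat split; lra). apply Rinv_le_contravar; auto.
  - right. field. split; lra.
Qed.

Lemma dgamma_continuous a b : path_continuous_on (dgamma G) a b.
Proof. intros t _. apply curve_smooth. Qed.

Lemma winding_vanishes : vanishes_at_infinity (winding_number G).
Proof.
  intros eps He. assert (N := two_pi_i_nz). assert (N' := proj1 (Cmod_gt_0 _) N).
  destruct (kernel_vanishes (dgamma G) (dgamma_continuous _ _) (Cmod two_pi_i * eps)) as [R HR].
  { now apply Rmult_lt_0_compat. }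
  exists R. intros z Hz. specialize (HR z Hz). rewrite winding_number_eq, Cmod_mult, Cmod_inv by auto.
  apply Rmult_le_reg_l with (Cmod two_pi_i); auto. rewrite <- Rmult_assoc, Rinv_r, Rmult_1_l by lra. exact HR.
Qed.

(** The winding number is constant along the ray from [z] to infinity, and
    tends to zero there. *)
Lemma winding_far : exists R, forall z, R < Cmod z -> off_curve G z /\ winding_number G z = 0.
Proof.
  destruct curve_bounded as [M [HM H]]. exists M.
  assert (Hoff : forall z, M < Cmod z -> off_curve G z) by (intros z Hz [t <-]; specialize (H t); lra).
  intros z Hz. split; auto.
  apply Cmod_eq_0, Rle_antisym; [|apply Cmod_ge_0].
  apply le_epsilon. intros eps He. rewrite Rplus_0_l.
  destruct (winding_vanishes eps He) as [R HR].
  set (s := 1 + Rabs R / Cmod z + 1). assert (Hs : 1 <= s).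
  { unfold s. assert (0 <= Rabs R / Cmod z). apply Rmult_le_pos; [apply Rabs_pos|apply Rlt_le, Rinv_0_lt_compat; lra]. lra. }
  replace (winding_number G z) with (winding_number G (RtoC s * z)).
  - apply HR. rewrite Cmod_mult, Cmod_R, Rabs_pos_eq by lra. unfold s.
    replace ((1 + Rabs R / Cmod z + 1) * Cmod z) with (2 * Cmod z + Rabs R) by (field; lra).
    assert (K := Rle_abs R). lra.
  - apply holo_deriv_zero_const. intros t Ht. apply winding_deriv, Hoff.
    replace (seg z (RtoC s * z) t) with (RtoC (1 + t * (s - 1)) * z)%C.
    + rewrite Cmod_mult, Cmod_R. assert (0 <= t * (s - 1)) by (apply Rmult_le_pos; lra).
      rewrite Rabs_pos_eq by lra. apply Rlt_le_trans with (1 * Cmod z); [lra|]. apply Rmult_le_compat_r; lra.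
    + unfold seg. rewrite RtoC_plus, RtoC_mult, RtoC_minus. ring.
Qed.

(** The winding number is locally constant, hence constant on connected
    sets. *)
Lemma winding_component z w : component (off_curve G) z w -> winding_number G w = winding_number G z.
Proof.
  intros [S [Hc [HS [Hz Hw]]]]. apply NNPP. intros Hne.
  destruct (Hc (fun u => off_curve G u /\ winding_number G u = winding_number G z)
               (fun u => off_curve G u /\ winding_number G u <> winding_number G z)) as [u [_ [[_ H1] [_ H2]]]].
  - apply open_C_iff. intros u [Hu E]. destruct (winding_locally_const u Hu) as [d [Hd H]].
    exists d; split; auto. intros v Hv. destruct (H v Hv) as [H1 H2]. split; congruence.
  - apply open_C_iff. intros u [Hu E]. destruct (winding_locally_const u Hu) as [d [Hd H]].
    exists d; split; auto. intros v Hv. destruct (H v Hv) as [H1 H2]. split; congruence.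
  - intros u Hu. destruct (classic (winding_number G u = winding_number G z)); [left|right]; auto.
  - exists z; auto.
  - exists w; auto.
  - contradiction.
Qed.

Lemma winding_D_minus z : D_minus G z -> winding_number G z = 0.
Proof.
  intros [Hz Hu]. destruct winding_far as [R HR]. apply NNPP. intros Hne. apply Hu.
  exists R. intros w Hw. destruct (Rle_dec (Cmod w) R) as [H|H]; auto.
  exfalso. apply Hne. rewrite <- (winding_component z w Hw). apply HR. lra.
Qed.

Lemma D_cases z : off_curve G z -> D_plus G z \/ D_minus G z.
Proof. intros H. destruct (classic (bounded_C (component (off_curve G) z))); [left|right]; split; auto. Qed.

Lemma periodic_integral_shift f a : (forall t, f (t + T) = f t) -> (forall t, @continuous R_UniformSpace CU f t) ->
  path_int f a (a + T) = path_int f 0 T.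
Proof.
  intros Hp Hc.
  assert (Hex : forall x y, @ex_RInt C_R_NormedModule f x y).
  { intros x y. apply (@ex_RInt_continuous C_R_CompleteNormedModule). intros t _. apply continuous_CU_codomain, Hc. }
  assert (Ch : forall x y z, (path_int f x y + path_int f y z)%C = path_int f x z).
  { intros x y z. apply (@RInt_Chasles C_R_CompleteNormedModule); apply Hex. }
  assert (E : path_int f T (a + T) = path_int f 0 a).
  { transitivity (@RInt C_R_CompleteNormedModule f (1 * 0 + T) (1 * a + T)); [replace (1 * 0 + T) with T by ring; replace (1 * a + T) with (a + T) by ring; reflexivity|].
    rewrite <- (@RInt_comp_lin C_R_CompleteNormedModule); [|apply Hex].
    apply (@RInt_ext C_R_CompleteNormedModule). intros t _. rewrite scal_R_Cmult.
    replace (1 * t + T) with (t + T) by ring. rewrite Hp. exact (Cmult_1_l (f t)). }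
  rewrite <- (Ch a T (a + T)), E, <- (Ch 0 a T). ring.
Qed.

Lemma Re_path_int_ge f a b m : a <= b -> path_continuous_on f a b -> (forall t, a <= t <= b -> m <= Re (f t)) ->
  (b - a) * m <= Re (path_int f a b).
Proof.
  intros Hab Hc Hm.
  assert (H := @is_RInt_fct_extend_fst R_NormedModule R_NormedModule f a b _ (path_int_is f a b Hab Hc)).
  apply (is_RInt_le (fun _ => m) (fun t => fst (f t)) a b); auto.
  - apply (is_RInt_const (V := R_NormedModule)).
  - intros t Ht. apply Hm; lra.
Qed.

(** The integrand of the jump below, in a parameter where the curve is u = s +
    r with velocity u' = 1 + rho: when [r] and [rho] are small, the quotient
    eps u' / (u^2 + eps^2) differs from the Poisson kernel eps / (s^2 + eps^2)
    by a factor within distance 1/2 of one. *)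
Lemma poisson_kernel_lower (s eps : R) (r rho : C) : 0 < eps -> Cmod r <= Rabs s / 10 -> Cmod rho <= / 10 ->
  let D := ((RtoC s + r) * (RtoC s + r) + RtoC eps * RtoC eps)%C in
  D <> RtoC 0 /\ eps / (2 * (s * s + eps * eps)) <= Re (RtoC eps * (1 + rho) / D)%C.
Proof.
  intros He Hr Hrho D. set (N := s * s + eps * eps).
  assert (Hs2 : Rabs s * Rabs s = s * s) by (rewrite <- Rabs_mult; apply Rabs_pos_eq; nra).
  assert (HN : 0 < N) by (unfold N; nra).
  assert (NC : RtoC N <> RtoC 0) by (intros E; apply RtoC_inj in E; lra).
  set (e := (2 * RtoC s * r + r * r)%C).
  assert (ED : D = (RtoC N + e)%C) by (unfold D, N, e; rewrite RtoC_plus, !RtoC_mult; ring).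
  assert (Hr0 := Cmod_ge_0 r). assert (Hs0 := Rabs_pos s).
  assert (Hee : Cmod e <= 21 / 100 * N).
  { unfold e. eapply Rle_trans; [apply Cmod_triangle|]. rewrite !Cmod_mult, !Cmod_R, (Rabs_pos_eq 2) by lra.
    assert (2 * Rabs s * Cmod r <= 2 * Rabs s * (Rabs s / 10)) by (apply Rmult_le_compat_l; lra).
    assert (Cmod r * Cmod r <= Rabs s / 10 * (Rabs s / 10)) by (apply Rmult_le_compat; lra).
    unfold N. nra. }
  assert (HD : 79 / 100 * N <= Cmod D).
  { rewrite ED. replace (RtoC N + e)%C with (RtoC N - - e)%C by ring.
    assert (K := Cmod_triangle_rev (RtoC N) (- e)). rewrite Cmod_opp, Cmod_R, Rabs_pos_eq in K; lra. }
  assert (HD0 : D <> RtoC 0) by (apply Cmod_nz; lra).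
  split; auto.
  set (Y := ((1 + rho) * RtoC N / D - 1)%C).
  assert (HY : Cmod Y <= 1 / 2).
  { replace Y with ((rho * RtoC N - e) / D)%C.
    2: { unfold Y. replace (rho * RtoC N - e)%C with ((1 + rho) * RtoC N - D)%C by (rewrite ED; ring). field; auto. }
    rewrite Cmod_div by auto. apply Rmult_le_reg_r with (Cmod D); [lra|].
    unfold Rdiv. rewrite Rmult_assoc, Rinv_l, Rmult_1_r by lra.
    unfold Cminus. eapply Rle_trans; [apply Cmod_triangle|]. rewrite Cmod_opp, Cmod_mult, Cmod_R, Rabs_pos_eq by lra.
    assert (Cmod rho * N <= / 10 * N) by (apply Rmult_le_compat_r; lra). lra. }
  replace (RtoC eps * (1 + rho) / D)%C with (RtoC (eps / N) * (1 + Y))%C.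
  2: { unfold Y. rewrite RtoC_div by lra. field. split; auto. }
  rewrite re_scal_l, re_plus, re_RtoC.
  assert (K := re_le_Cmod Y). assert (K2 := Rle_abs (- Re Y)). rewrite Rabs_Ropp in K2.
  replace (eps / (2 * N)) with (eps / N * (1 / 2)) by (field; lra).
  apply Rmult_le_compat_l; [apply Rlt_le, Rdiv_lt_0_compat; auto|lra].
Qed.

Lemma curve_away t0 delta : 0 < delta < T / 2 -> exists d, 0 < d /\
  forall t, t0 - T / 2 <= t <= t0 + T / 2 -> delta <= Rabs (t - t0) -> d <= Cmod (gamma G t - gamma G t0).
Proof.
  intros Hd. assert (HT := period_gt0).
  assert (Hc : forall a b, path_continuous_on (fun t => gamma G t - gamma G t0)%C a b).
  { intros a b t _. assert (K := curve_cont t). ccont. }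
  destruct (path_away_from_zero (fun t => gamma G t - gamma G t0)%C (t0 + delta) (t0 + T/2)) as [d1 [Hd1 H1]]; [lra|apply Hc| |].
  { intros t Ht. apply Cminus_eq_contra. intros E. apply curve_injective in E; [lra|]. rewrite Rabs_pos_eq; lra. }
  destruct (path_away_from_zero (fun t => gamma G t - gamma G t0)%C (t0 - T/2) (t0 - delta)) as [d2 [Hd2 H2]]; [lra|apply Hc| |].
  { intros t Ht. apply Cminus_eq_contra. intros E. apply curve_injective in E; [lra|]. rewrite Rabs_left1; lra. }
  exists (Rmin d1 d2). split; [now apply Rmin_pos|]. intros t Ht Hdt.
  unfold Rabs in Hdt. destruct (Rcase_abs (t - t0)).
  - eapply Rle_trans; [apply Rmin_r|]. apply H2; lra.
  - eapply Rle_trans; [apply Rmin_l|]. apply H1; lra.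
Qed.

(** The two points are placed symmetrically on the normal. The difference of
    the winding numbers is [/ PI] times the integral of [q], the kernel eps u'
    / (u^2 + eps^2). Near [t0] its real part is nonnegative, and at least 1 /
    (4 eps) on an interval of length 2 eps, which contributes 1/2; away from
    [t0] the kernel is of order [eps]. For small [eps] the difference is
    therefore not zero. *)
Lemma winding_jump t0 : exists e0, 0 < e0 /\ forall eps, 0 < eps < e0 ->
  let h := (Ci * RtoC eps * dgamma G t0)%C in
  off_curve G (gamma G t0 + h)%C /\ off_curve G (gamma G t0 - h)%C /\
  winding_number G (gamma G t0 + h)%C <> winding_number G (gamma G t0 - h)%C.
Proof.
  assert (HT := period_gt0).
  set (z0 := gamma G t0). set (v := dgamma G t0).
  assert (Hv : v <> RtoC 0) by apply dgamma_neq0. assert (Hv' := proj1 (Cmod_gt_0 _) Hv).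
  destruct (proj1 (is_derive_path_iff _ _ _) (gamma_deriv G t0) (Cmod v / 10)) as [d1 [Hd1 H1]]; [lra|].
  destruct (proj1 (continuous_path_iff _ _) (proj2 curve_smooth t0) (Cmod v / 10)) as [d2 [Hd2 H2]]; [lra|].
  set (delta := Rmin (Rmin d1 d2) (T / 2) / 2).
  assert (Hmin : 0 < Rmin (Rmin d1 d2) (T / 2)) by (repeat apply Rmin_pos; lra).
  assert (M1 := Rmin_l (Rmin d1 d2) (T / 2)). assert (M2 := Rmin_r (Rmin d1 d2) (T / 2)).
  assert (M3 := Rmin_l d1 d2). assert (M4 := Rmin_r d1 d2).
  assert (Hdelta : 0 < delta < T / 2) by (unfold delta; lra).
  destruct (curve_away t0 delta Hdelta) as [d [Hd H3]].
  destruct (path_bounded (dgamma G) (t0 - T / 2) (t0 + T / 2)) as [L [HL H4]]; [lra|apply dgamma_continuous|].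
  (* [K * eps] bounds the kernel away from [t0], where the denominator is at
     least [d * d / 4]; [e2] makes its total contribution less than 1/4. *)
  set (K := L * Cmod v * 4 / (d * d)).
  assert (HK : 0 < K). { unfold K. apply Rdiv_lt_0_compat; repeat apply Rmult_lt_0_compat; lra. }
  set (e1 := Rmin delta (d / (2 * Cmod v))).
  set (e2 := / (4 * (T * K))).
  assert (HTK : 0 < T * K) by now apply Rmult_lt_0_compat.
  assert (Hdv : 0 < d / (2 * Cmod v)) by (apply Rdiv_lt_0_compat; lra).
  assert (He2 : 0 < e2) by (apply Rinv_0_lt_compat; lra).
  exists (Rmin e1 e2). split. { unfold e1. repeat apply Rmin_pos; lra. }
  intros eps Heps h.
  assert (Heps1 : eps < delta). { eapply Rlt_le_trans; [apply Heps|]. eapply Rle_trans; [apply Rmin_l|apply Rmin_l]. }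
  assert (Heps2 : eps * Cmod v < d / 2).
  { replace (d / 2) with (d / (2 * Cmod v) * Cmod v) by (field; lra). apply Rmult_lt_compat_r; auto.
    eapply Rlt_le_trans; [apply Heps|]. eapply Rle_trans; [apply Rmin_l|apply Rmin_r]. }
  assert (Heps3 : T * K * eps < 1 / 4).
  { replace (1 / 4) with (T * K * e2) by (unfold e2; field; split; lra). apply Rmult_lt_compat_l; auto.
    eapply Rlt_le_trans; [apply Heps|]. apply Rmin_r. }
  assert (Hh : Cmod h = eps * Cmod v). { unfold h. rewrite !Cmod_mult, Cmod_Ci, Cmod_R, Rabs_pos_eq; lra. }
  (* [2 * Ci * q] is the difference of the integrands at [z0 + h] and [z0 - h]. *)
  set (den := fun t => ((gamma G t - (z0 + h)) * (gamma G t - (z0 - h)))%C).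
  set (q := fun t => (dgamma G t * (RtoC eps * v) / den t)%C).
  assert (Hden : forall t, den t = ((gamma G t - z0) * (gamma G t - z0) + RtoC eps * RtoC eps * v * v)%C).
  { intros t. unfold den, h. fold v.
    transitivity ((gamma G t - z0) * (gamma G t - z0) - (Ci * Ci) * (RtoC eps * RtoC eps * v * v))%C; [ring|].
    replace (Ci * Ci)%C with (- RtoC 1)%C. ring. unfold Ci, Cmult, Copp, RtoC; simpl. f_equal; ring. }
  assert (near : forall t, Rabs (t - t0) <= delta -> den t <> RtoC 0 /\
     eps / (2 * ((t - t0) * (t - t0) + eps * eps)) <= Re (q t)).
  { intros t Ht. specialize (H1 t ltac:(unfold delta in Ht; lra)). specialize (H2 t ltac:(unfold delta in Ht; lra)).
    fold z0 v in H1, H2.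
    set (r := ((gamma G t - z0 - v * RtoC (t - t0)) / v)%C). set (rho := ((dgamma G t - v) / v)%C).
    assert (Hr : Cmod r <= Rabs (t - t0) / 10).
    { unfold r. rewrite Cmod_div by auto. apply Rmult_le_reg_r with (Cmod v); auto.
      unfold Rdiv at 1. rewrite Rmult_assoc, Rinv_l, Rmult_1_r by lra. lra. }
    assert (Hrho : Cmod rho <= / 10).
    { unfold rho. rewrite Cmod_div by auto. apply Rmult_le_reg_r with (Cmod v); auto.
      unfold Rdiv at 1. rewrite Rmult_assoc, Rinv_l, Rmult_1_r by lra. lra. }
    destruct (poisson_kernel_lower (t - t0) eps r rho (proj1 Heps) Hr Hrho) as [P1 P2].
    set (D := ((RtoC (t - t0) + r) * (RtoC (t - t0) + r) + RtoC eps * RtoC eps)%C) in *.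
    assert (E : den t = (v * v * D)%C). { rewrite Hden. unfold D, r. field. auto. }
    split. { rewrite E. repeat apply Cmult_neq_0; auto. }
    replace (q t) with (RtoC eps * (1 + rho) / D)%C; auto. unfold q. rewrite E. unfold rho. field. split; auto. }
  assert (far : forall t, t0 - T / 2 <= t <= t0 + T / 2 -> delta <= Rabs (t - t0) ->
     d * d / 4 <= Cmod (den t)).
  { intros t Ht Hdt. specialize (H3 t Ht Hdt). fold z0 in H3. unfold den. rewrite Cmod_mult.
    replace (d * d / 4) with (d / 2 * (d / 2)) by field. apply Rmult_le_compat; try lra.
    - replace (gamma G t - (z0 + h))%C with ((gamma G t - z0) - h)%C by ring.
      assert (K1 := Cmod_triangle_rev (gamma G t - z0) h). lra.
    - replace (gamma G t - (z0 - h))%C with ((gamma G t - z0) - - h)%C by ring.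
      assert (K1 := Cmod_triangle_rev (gamma G t - z0) (- h)). rewrite Cmod_opp in K1. lra. }
  assert (Hden0 : forall t, t0 - T / 2 <= t <= t0 + T / 2 -> den t <> RtoC 0).
  { intros t Ht. destruct (Rle_dec (Rabs (t - t0)) delta) as [Hc|Hc]; [now apply near|].
    apply Cmod_nz. assert (F := far t Ht ltac:(lra)). assert (0 < d * d) by nra. lra. }
  assert (Hne : forall t, den t <> RtoC 0).
  { intros t. destruct (curve_window (t0 - T / 2) t) as [s [Hs E]].
    unfold den. rewrite <- E. apply Hden0. lra. }
  assert (Hp : off_curve G (z0 + h)%C). { intros [t Ht]. apply (Hne t). unfold den. rewrite Ht. ring. }
  assert (Hm : off_curve G (z0 - h)%C). { intros [t Ht]. apply (Hne t). unfold den. rewrite Ht. ring. }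
  split; [exact Hp|split; [exact Hm|]].
  assert (lower : forall t, t0 - T / 2 <= t <= t0 + T / 2 -> - (K * eps) <= Re (q t)).
  { intros t Ht. destruct (Rle_dec (Rabs (t - t0)) delta) as [Hc|Hc].
    - apply Rle_trans with 0; [assert (0 < K * eps) by (apply Rmult_lt_0_compat; lra); lra|].
      eapply Rle_trans; [|apply (near t Hc)]. apply Rlt_le, Rdiv_lt_0_compat; [lra|].
      assert (0 < eps * eps) by (apply Rmult_lt_0_compat; lra).
      assert (0 <= (t - t0) * (t - t0)) by apply Rle_0_sqr. lra.
    - assert (F := far t Ht ltac:(lra)). assert (Hdd : 0 < d * d) by nra.
      assert (B : Cmod (q t) <= K * eps).
      { unfold q. rewrite Cmod_div, !Cmod_mult, Cmod_R, Rabs_pos_eq by (auto; lra).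
        apply Rmult_le_reg_r with (Cmod (den t)); [lra|]. unfold Rdiv. rewrite Rmult_assoc, Rinv_l, Rmult_1_r by lra.
        apply Rle_trans with (K * eps * (d * d / 4)).
        - unfold K. replace (L * Cmod v * 4 / (d * d) * eps * (d * d / 4)) with (L * (eps * Cmod v)) by (field; lra).
          apply Rmult_le_compat_r; [apply Rmult_le_pos; lra|]. now apply H4.
        - apply Rmult_le_compat_l; auto. apply Rmult_le_pos; lra. }
      assert (K1 := re_le_Cmod (q t)). assert (K2 := Rle_abs (- Re (q t))). rewrite Rabs_Ropp in K2. lra. }
  assert (centre : forall t, t0 - eps <= t <= t0 + eps -> / (4 * eps) <= Re (q t)).
  { intros t Ht. eapply Rle_trans; [|apply (near t); apply Rabs_le; lra].
    assert (Hs : (t - t0) * (t - t0) <= eps * eps) by nra.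
    assert (0 < eps * eps) by nra. assert (0 <= (t - t0) * (t - t0)) by apply Rle_0_sqr.
    replace (/ (4 * eps)) with (eps / (2 * (eps * eps + eps * eps))) by (field; lra).
    apply Rmult_le_compat_l; [lra|]. apply Rinv_le_contravar; lra. }
  assert (Cq : forall t, @continuous R_UniformSpace CU q t).
  { intros t. unfold q, den. assert (C1 := curve_cont t). assert (C2 := proj2 curve_smooth t). ccont. apply Hne. }
  assert (Pq : forall a b, path_continuous_on q a b) by (intros a b t _; apply Cq).
  assert (Hre : 0 < Re (path_int q (t0 - T / 2) (t0 + T / 2))).
  { rewrite <- (path_int_Chasles q (t0 - T/2) (t0 - eps) (t0 + T/2)) by (auto; lra).
    rewrite <- (path_int_Chasles q (t0 - eps) (t0 + eps) (t0 + T/2)) by (auto; lra).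
    rewrite !re_plus.
    assert (I1 := Re_path_int_ge q (t0 - T/2) (t0 - eps) (- (K * eps)) ltac:(lra) (Pq _ _) ltac:(intros; apply lower; lra)).
    assert (I2 := Re_path_int_ge q (t0 - eps) (t0 + eps) (/ (4 * eps)) ltac:(lra) (Pq _ _) ltac:(intros; apply centre; lra)).
    assert (I3 := Re_path_int_ge q (t0 + eps) (t0 + T/2) (- (K * eps)) ltac:(lra) (Pq _ _) ltac:(intros; apply lower; lra)).
    replace ((t0 + eps - (t0 - eps)) * / (4 * eps)) with (1 / 2) in I2 by (field; lra).
    assert (0 < K * eps) by (apply Rmult_lt_0_compat; lra). nra. }
  replace (t0 + T / 2) with (t0 - T / 2 + T) in Hre by field.
  rewrite periodic_integral_shift in Hre; [|intros t|exact Cq].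
  2: { unfold q, den. rewrite gamma_periodic, dgamma_periodic. reflexivity. }
  intros E. rewrite !winding_number_eq in E.
  assert (E' : index_integral (z0 + h) = index_integral (z0 - h)).
  { assert (N := two_pi_i_nz). transitivity (two_pi_i * (/ two_pi_i * index_integral (z0 + h)))%C; [field; auto|].
    rewrite E. field; auto. }
  assert (Z : (2 * Ci * path_int q 0 T)%C = 0).
  { rewrite <- path_int_scal by auto. transitivity (index_integral (z0 + h) - index_integral (z0 - h))%C; [|rewrite E'; ring].
    assert (Kp : path_continuous_on (fun t => dgamma G t * (/ (gamma G t - (z0 + h))) ^ 1)%C 0 T).
    { apply kernel_continuous; [apply dgamma_continuous|intros t _; apply curve_cont|intros t _; now apply off_curve_ne]. }
    assert (Km : path_continuous_on (fun t => dgamma G t * (/ (gamma G t - (z0 - h))) ^ 1)%C 0 T).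
    { apply kernel_continuous; [apply dgamma_continuous|intros t _; apply curve_cont|intros t _; now apply off_curve_ne]. }
    unfold index_integral, kernel_int. rewrite <- path_int_minus by auto.
    apply path_int_ext; auto. intros t _. rewrite !Cpow_1_r.
    assert (N1 := Cminus_eq_contra _ _ (off_curve_ne _ t Hp)). assert (N2 := Cminus_eq_contra _ _ (off_curve_ne _ t Hm)).
    unfold q, den.
    transitivity (dgamma G t * (2 * h) / ((gamma G t - (z0 + h)) * (gamma G t - (z0 - h))))%C.
    unfold h. fold v. field; auto. field; auto. }
  assert (Z2 : path_int q 0 T = 0).
  { apply NNPP. intros Hn. revert Z. repeat apply Cmult_neq_0; auto; [|apply Ci_nz]. intros E2; apply RtoC_inj in E2; lra. }
  rewrite Z2 in Hre. simpl in Hre. lra.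
Qed.

Context (ccw : counterclockwise G).

(** This replaces the Jordan curve theorem. Off the curve the winding number
    is one on [D_plus] and zero on [D_minus], so the two points of the jump,
    arbitrarily close to [z], lie in different domains. *)
Lemma domains_adherent z r : on_curve G z -> 0 < r ->
  (exists w, Cmod (w - z) < r /\ D_plus G w) /\ (exists w, Cmod (w - z) < r /\ D_minus G w).
Proof.
  intros [t0 <-] Hr. destruct (winding_jump t0) as [e0 [He0 H]].
  set (v := dgamma G t0). assert (Hv : 0 <= Cmod v) by apply Cmod_ge_0.
  set (eps := Rmin (e0 / 2) (r / (Cmod v + 1) / 2)).
  assert (Hq : 0 < r / (Cmod v + 1)) by (apply Rdiv_lt_0_compat; lra).
  assert (Hm : 0 < eps) by (apply Rmin_pos; lra).
  assert (M1 := Rmin_l (e0 / 2) (r / (Cmod v + 1) / 2)). assert (M2 := Rmin_r (e0 / 2) (r / (Cmod v + 1) / 2)).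
  fold eps in M1, M2.
  specialize (H eps ltac:(lra)). fold v in H. set (h := (Ci * RtoC eps * v)%C) in H. simpl in H.
  destruct H as [Hp [Hn Hne]].
  assert (Hh : Cmod h < r).
  { unfold h. rewrite !Cmod_mult, Cmod_Ci, Cmod_R, Rabs_pos_eq by lra.
    replace r with (r / (Cmod v + 1) * (Cmod v + 1)) by (field; lra).
    apply Rle_lt_trans with (r / (Cmod v + 1) * Cmod v).
    apply Rmult_le_compat_r; lra. apply Rmult_lt_compat_l; lra. }
  assert (B1 : Cmod (gamma G t0 + h - gamma G t0) < r) by (replace (gamma G t0 + h - gamma G t0)%C with h by ring; auto).
  assert (B2 : Cmod (gamma G t0 - h - gamma G t0) < r) by (replace (gamma G t0 - h - gamma G t0)%C with (-h)%C by ring; now rewrite Cmod_opp).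
  destruct (D_cases _ Hp) as [P1|P1]; destruct (D_cases _ Hn) as [P2|P2].
  - exfalso; apply Hne. rewrite (ccw _ P1), (ccw _ P2); auto.
  - split; eexists; split; [exact B1|exact P1|exact B2|exact P2].
  - split; eexists; split; [exact B2|exact P2|exact B1|exact P1].
  - exfalso; apply Hne. rewrite (winding_D_minus _ P1), (winding_D_minus _ P2); auto.
Qed.

End Curve.

(** * Cauchy's formula for the curve *)

(** Writing g(v) = g(z) + (v - z) g'(z) + (v - z)^2 g2(v), this is the
    identity between divided differences g[p,w] - g[z,w] - (p - z) g[z,z,w] =
    (p - z)^2 g[z,z,p,w]. *)
Lemma slope_second_difference U g p w z : open_C U -> holomorphic U g -> U z -> U p ->
  let g2 := slope (slope g z) z in
  (slope g p w - slope g z w - (p - z) * g2 w = (p - z) * (p - z) * slope g2 p w)%C.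
Proof.
  intros HU Hg Hz Hp g2. set (g1 := slope g z).
  assert (E : forall v, g v = (g z + (v - z) * (g1 z + (v - z) * g2 v))%C).
  { intros v. rewrite (slope_spec g z v) at 1. fold g1. now rewrite (slope_spec g1 z v) at 1. }
  assert (H2 : holomorphic U g2) by (repeat apply slope_holomorphic; auto).
  fold g1. rewrite (slope_spec g1 z w). change (slope g1 z w) with (g2 w).
  destruct (Ceq_dec w p) as [->|Hne].
  - rewrite (slope_diag g p), (slope_diag g2 p).
    assert (D : C_derive g p = (0 + (1 * (g1 z + (p - z) * g2 p) + (p - z) * (0 + (1 * g2 p + (p - z) * C_derive g2 p))))%C).
    { apply is_C_derive_unique, is_derive_holo_deriv.
      assert (Hid : holo_deriv (fun v => (v - z)%C) p 1).
      { eapply holo_deriv_val; [apply holo_deriv_minus; [apply holo_deriv_id|apply holo_deriv_const]|ring]. }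
      apply (holo_deriv_ext_loc (fun v => g z + (v - z) * (g1 z + (v - z) * g2 v))%C g p _ 1); [lra| |].
      - intros v _. symmetry. apply E.
      - eapply holo_deriv_val.
        + apply holo_deriv_plus; [apply holo_deriv_const|].
          apply (holo_deriv_mult (fun v => v - z)%C (fun v => g1 z + (v - z) * g2 v)%C); [exact Hid|].
          apply holo_deriv_plus; [apply holo_deriv_const|].
          apply (holo_deriv_mult (fun v => v - z)%C g2); [exact Hid|now apply (holomorphic_deriv_at U)].
        + ring. }
    rewrite D. ring.
  - rewrite (slope_off g p w), (slope_off g2 p w), (E w), (E p) by auto.
    field. now apply Cminus_eq_contra.
Qed.

Section Dixon.
Context (G : simple_closed_curve) (U : C -> Prop) (g : C -> C) (kappa : C).
Context (HU : open_C U) (Hg : holomorphic U g) (HG : forall z, on_curve G z -> U z).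
Context (Hk : forall z, ~ U z -> winding_number G z = kappa).
Let T := period G.

(** The integrand of the contour integral of [g]; divided by [w - z] it gives
    the Cauchy integral. *)
Definition density (t : R) : C := (g (gamma G t) * dgamma G t)%C.
Definition cauchy_integral : C -> C := kernel_int density (gamma G) 1 0 T.
Definition slope_integral (z : C) : C := path_int (fun t => slope g z (gamma G t) * dgamma G t)%C 0 T.
(** Dixon's function. On [U] it is the integral of the difference quotient,
    corrected by [kappa]; outside [U] it is the Cauchy integral. Off the curve
    both are given by one formula, because the winding number equals [kappa]
    outside [U]. *)
Definition dixon (z : C) : C :=
  if excluded_middle_informative (U z)
  then (slope_integral z + two_pi_i * kappa * g z)%C
  else cauchy_integral z.

Lemma dixon_period_ge0 : 0 <= T.
Proof. apply period_ge0. Qed.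
#[local] Hint Resolve dixon_period_ge0 : core.

Lemma gamma_U t : U (gamma G t).
Proof. apply HG. now exists t. Qed.

Lemma comp_gamma_cont f t : holomorphic U f -> @continuous R_UniformSpace CU (fun t => f (gamma G t)) t.
Proof.
  intros Hf. apply (ccont_comp _ f (gamma G)); [apply curve_cont|].
  apply (holomorphic_continuous U); auto. apply gamma_U.
Qed.

Lemma comp_gamma_continuous f a b : holomorphic U f -> path_continuous_on (fun t => f (gamma G t) * dgamma G t)%C a b.
Proof.
  intros Hf t _. apply (ccont_mult _ (fun t => f (gamma G t))); [now apply comp_gamma_cont|apply curve_smooth].
Qed.

Lemma dixon_off_curve z : off_curve G z ->
  dixon z = (cauchy_integral z - two_pi_i * ((winding_number G z - kappa) * g z))%C.
Proof.
  intros Hz. unfold dixon. destruct (excluded_middle_informative (U z)) as [Uz|Uz].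
  - assert (E : slope_integral z = (cauchy_integral z - g z * index_integral G z)%C).
    { unfold slope_integral, cauchy_integral, index_integral, kernel_int.
      assert (K1 : path_continuous_on (fun t => density t * (/ (gamma G t - z)) ^ 1)%C 0 T).
      { apply kernel_continuous; [now apply comp_gamma_continuous|intros t _; apply curve_cont|intros t _; now apply off_curve_ne]. }
      assert (K2 : path_continuous_on (fun t => dgamma G t * (/ (gamma G t - z)) ^ 1)%C 0 T).
      { apply kernel_continuous; [apply dgamma_continuous|intros t _; apply curve_cont|intros t _; now apply off_curve_ne]. }
      fold T. rewrite <- path_int_scal, <- path_int_minus; [|auto|auto| |auto|auto].
      - apply path_int_ext; [auto|]. intros t _. assert (N := off_curve_ne G z t Hz). rewrite slope_off, !Cpow_1_r by auto.
        unfold density. field. now apply Cminus_eq_contra.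
      - intros t Ht. apply (ccont_mult _ (fun _ => g z)); [apply ccont_const|now apply K2]. }
    rewrite E, winding_number_eq. field. apply two_pi_i_nz.
  - rewrite Hk by auto. ring.
Qed.

Lemma cauchy_integral_deriv z : off_curve G z -> exists l, holo_deriv cauchy_integral z l.
Proof.
  intros Hz. eexists. apply kernel_deriv; [auto|now apply comp_gamma_continuous| |].
  intros t _; apply curve_cont. intros t _; now apply off_curve_ne.
Qed.

(** By the identity for second differences, the integral of [g2] is the
    derivative at [z], with an error (p - z)^2 times the integral of the slope
    of [g2] between [p] and the curve. That slope is bounded: near [z] by the
    local Lipschitz bound, and away from [z] because the denominator is. *)
Lemma slope_integral_deriv z : U z -> on_curve G z -> exists l, holo_deriv slope_integral z l.
Proof.
  intros Hz Hon. set (g2 := slope (slope g z) z).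
  assert (H2 : holomorphic U g2) by (repeat apply slope_holomorphic; auto).
  destruct (slope_bounded U g2 z HU H2 Hz) as [r [M [Hr [HM [Hball Hs]]]]].
  destruct (path_bounded (fun t => g2 (gamma G t)) 0 T dixon_period_ge0) as [B [HB H3]].
  { intros t _. now apply comp_gamma_cont. }
  destruct (path_bounded (dgamma G) 0 T dixon_period_ge0 (dgamma_continuous G _ _)) as [L [HL H4]].
  (* [N] bounds [g2] near [z], and [Q] bounds its slope between a point near [z]
     and any point of the curve. *)
  set (N := Cmod (g2 z) + r * M). assert (HN : 0 < N).
  { unfold N. assert (K := Cmod_ge_0 (g2 z)). assert (0 < r * M) by now apply Rmult_lt_0_compat. lra. }
  set (Q := M + (B + N) * (2 / r)).
  assert (H2r : 0 < 2 / r) by (apply Rdiv_lt_0_compat; lra).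
  assert (HBN : 0 < (B + N) * (2 / r)) by (apply Rmult_lt_0_compat; lra).
  assert (Hcross : forall p t, Cmod (p - z) < r / 2 -> 0 <= t <= T -> Cmod (slope g2 p (gamma G t)) <= Q).
  { intros p t Hp Ht. destruct (Rlt_dec (Cmod (gamma G t - z)) r) as [Hc|Hc].
    - apply Rle_trans with M; [apply Hs; lra|unfold Q; lra].
    - assert (D : r / 2 <= Cmod (gamma G t - p)).
      { replace (gamma G t - p)%C with ((gamma G t - z) - (p - z))%C by ring.
        assert (K := Cmod_triangle_rev (gamma G t - z) (p - z)). lra. }
      assert (Hne : gamma G t <> p). { intros E. rewrite E, Cmod_self in D. lra. }
      assert (Nz := Cminus_eq_contra _ _ Hne).
      assert (Hgp : Cmod (g2 p) <= N).
      { rewrite (slope_spec g2 z p). eapply Rle_trans; [apply Cmod_triangle|]. rewrite Cmod_mult. unfold N.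
        apply Rplus_le_compat_l. apply Rmult_le_compat; try apply Cmod_ge_0; [lra|].
        apply Hs; [rewrite Cmod_self|]; lra. }
      rewrite slope_off, Cmod_div by auto. apply Rle_trans with ((B + N) * (2 / r)); [|unfold Q; lra].
      apply Rmult_le_compat; [apply Cmod_ge_0|apply Rlt_le, Rinv_0_lt_compat; lra| |].
      + unfold Cminus. eapply Rle_trans; [apply Cmod_triangle|]. rewrite Cmod_opp. specialize (H3 t Ht). simpl in H3. lra.
      + replace (2 / r) with (/ (r / 2)) by (field; lra). apply Rinv_le_contravar; lra. }
  exists (path_int (fun t => g2 (gamma G t) * dgamma G t)%C 0 T). intros eps He.
  assert (HT := period_gt0 G : 0 < T).
  assert (HQ : 0 < Q) by (unfold Q; lra).
  set (W := T * (Q * L)). assert (HW : 0 < W) by (unfold W; repeat apply Rmult_lt_0_compat; auto).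
  exists (Rmin (r / 2) (eps / W)). split; [apply Rmin_pos; [lra|now apply Rdiv_lt_0_compat]|].
  intros p Hp. assert (Hp1 := Rlt_le_trans _ _ _ Hp (Rmin_l _ _)). assert (Hp2 := Rlt_le_trans _ _ _ Hp (Rmin_r _ _)).
  assert (Up : U p) by (apply Hball; lra).
  assert (Hz1 : holomorphic U (slope g z)) by now apply slope_holomorphic.
  assert (Hp3 : holomorphic U (slope g p)) by now apply slope_holomorphic.
  assert (Hp4 : holomorphic U (slope g2 p)) by now apply slope_holomorphic.
  assert (Ck : path_continuous_on (fun t => (p - z) * (g2 (gamma G t) * dgamma G t))%C 0 T).
  { intros t Ht. apply (ccont_mult _ (fun _ => (p - z)%C)); [apply ccont_const|now apply comp_gamma_continuous with (a := 0) (b := T)]. }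
  assert (Cd : path_continuous_on (fun t => slope g p (gamma G t) * dgamma G t - slope g z (gamma G t) * dgamma G t)%C 0 T).
  { intros t Ht. apply (ccont_minus _ (fun t => slope g p (gamma G t) * dgamma G t)%C (fun t => slope g z (gamma G t) * dgamma G t)%C);
    [now apply comp_gamma_continuous with (a := 0) (b := T)|now apply comp_gamma_continuous with (a := 0) (b := T)]. }
  assert (C2 := comp_gamma_continuous _ 0 T H2).
  assert (C4 := comp_gamma_continuous _ 0 T Hp4).
  assert (E : (slope_integral p - slope_integral z - path_int (fun t => g2 (gamma G t) * dgamma G t) 0 T * (p - z) =
    (p - z) * (p - z) * path_int (fun t => slope g2 p (gamma G t) * dgamma G t) 0 T)%C).
  { rewrite (Cmult_comm (path_int _ _ _) (p - z)). unfold slope_integral.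
    rewrite <- !path_int_scal by auto.
    rewrite <- path_int_minus by (auto; now apply comp_gamma_continuous).
    rewrite <- path_int_minus by auto.
    apply path_int_ext; [auto|]. intros t _.
    transitivity ((slope g p (gamma G t) - slope g z (gamma G t) - (p - z) * g2 (gamma G t)) * dgamma G t)%C; [ring|].
    assert (S := slope_second_difference U g p (gamma G t) z HU Hg Hz Up). cbv zeta in S. fold g2 in S.
    rewrite S. ring. }
  rewrite E, !Cmod_mult. set (k := Cmod (p - z)) in *. assert (Hk0 : 0 <= k) by apply Cmod_ge_0.
  assert (I : Cmod (path_int (fun t => slope g2 p (gamma G t) * dgamma G t)%C 0 T) <= (T - 0) * (Q * L)).
  { apply path_int_bound; auto. intros t Ht. rewrite Cmod_mult. apply Rmult_le_compat; auto; apply Cmod_ge_0. }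
  rewrite Rminus_0_r in I. fold W in I.
  apply Rle_trans with (k * k * W). { apply Rmult_le_compat_l; auto. now apply Rmult_le_pos. }
  replace (eps * k) with (eps / W * W * k) by (field; lra).
  replace (k * k * W) with (k * W * k) by ring.
  apply Rmult_le_compat_r; auto. apply Rmult_le_compat_r; lra.
Qed.

(** Only points of the curve need the difference quotient; elsewhere the
    winding number is locally constant and the Cauchy integral is
    differentiable. *)
Lemma dixon_entire z : exists l, holo_deriv dixon z l.
Proof.
  destruct (classic (on_curve G z)) as [Hon|Hoff].
  - assert (Uz := HG z Hon). destruct (slope_integral_deriv z Uz Hon) as [l Hl].
    destruct (proj1 (open_C_iff U) HU z Uz) as [r [Hr Hb]].
    eexists. apply (holo_deriv_ext_loc (fun w => slope_integral w + two_pi_i * kappa * g w)%C dixon z _ r Hr).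
    + intros w Hw. unfold dixon. destruct (excluded_middle_informative (U w)) as [Uw|Uw]; [reflexivity|].
      exfalso; apply Uw; auto.
    + apply holo_deriv_plus; [exact Hl|]. apply holo_deriv_scal. now apply (holomorphic_deriv_at U).
  - fold (off_curve G z) in Hoff. destruct (winding_locally_const G z Hoff) as [d [Hd H]].
    destruct (cauchy_integral_deriv z Hoff) as [l Hl].
    destruct (classic (winding_number G z = kappa)) as [E|E].
    + exists l. apply (holo_deriv_ext_loc cauchy_integral dixon z _ d Hd); auto.
      intros w Hw. destruct (H w Hw) as [H1 H2]. rewrite dixon_off_curve, H2, E by auto. ring.
    + assert (Uz : U z) by (apply NNPP; auto).
      eexists. apply (holo_deriv_ext_loc (fun w => cauchy_integral w - two_pi_i * ((winding_number G z - kappa) * g w))%C dixon z _ d Hd).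
      * intros w Hw. destruct (H w Hw) as [H1 H2]. rewrite dixon_off_curve, H2 by auto. reflexivity.
      * apply holo_deriv_minus; [exact Hl|]. apply holo_deriv_scal, holo_deriv_scal. now apply (holomorphic_deriv_at U).
Qed.

Lemma density_continuous : path_continuous_on density 0 T.
Proof. now apply comp_gamma_continuous. Qed.

Context (Hv : vanishes_at_infinity (fun z => (winding_number G z - kappa) * g z)%C).

Lemma dixon_vanishes : vanishes_at_infinity dixon.
Proof.
  intros eps He. assert (Nc := proj1 (Cmod_gt_0 _) two_pi_i_nz).
  destruct (kernel_vanishes G density density_continuous (eps / 2)) as [R1 H1]; [lra|].
  destruct (Hv (eps / 2 / Cmod two_pi_i)) as [R2 H2]. { apply Rdiv_lt_0_compat; lra. }
  destruct (winding_far G) as [R3 H3].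
  exists (Rmax R1 (Rmax R2 R3)). intros z Hz.
  assert (Hz1 := Rle_lt_trans _ _ _ (Rmax_l _ _) Hz). assert (Hz' := Rle_lt_trans _ _ _ (Rmax_r _ _) Hz).
  assert (Hz2 := Rle_lt_trans _ _ _ (Rmax_l _ _) Hz'). assert (Hz3 := Rle_lt_trans _ _ _ (Rmax_r _ _) Hz').
  rewrite dixon_off_curve by now apply H3.
  unfold Cminus at 1. eapply Rle_trans; [apply Cmod_triangle|]. rewrite Cmod_opp, Cmod_mult.
  specialize (H1 z Hz1). specialize (H2 z Hz2).
  assert (Cmod two_pi_i * Cmod ((winding_number G z - kappa) * g z) <= Cmod two_pi_i * (eps / 2 / Cmod two_pi_i))
    by (apply Rmult_le_compat_l; lra).
  replace (Cmod two_pi_i * (eps / 2 / Cmod two_pi_i)) with (eps / 2) in H by (field; lra).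
  unfold cauchy_integral, T. lra.
Qed.

(** Dixon's function is entire and vanishes at infinity, so it is zero. *)
Theorem cauchy_integral_formula z : off_curve G z ->
  cauchy_integral z = (two_pi_i * ((winding_number G z - kappa) * g z))%C.
Proof.
  intros Hz. assert (E := entire_vanishing dixon dixon_entire dixon_vanishes z).
  rewrite dixon_off_curve in E by auto. now apply Ceq_minus.
Qed.

(** As [z] tends to infinity, [z] times the Cauchy integral tends to minus the
    contour integral, by z / (w - z) = w / (w - z) - 1; Cauchy's formula
    evaluates the limit. *)
Theorem contour_integral_zero :
  vanishes_at_infinity (fun z => z * ((winding_number G z - kappa) * g z))%C -> contour_integral G g = 0.
Proof.
  intros Hz. apply Cmod_eq_0, Rle_antisym; [|apply Cmod_ge_0].
  apply le_epsilon. intros eps He. rewrite Rplus_0_l.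
  change (contour_integral G g) with (path_int density 0 T).
  assert (Nc := proj1 (Cmod_gt_0 _) two_pi_i_nz).
  set (phi := fun t => (density t * gamma G t)%C).
  assert (Cphi : path_continuous_on phi 0 T).
  { intros t Ht. apply (ccont_mult _ density); [now apply density_continuous|apply curve_cont]. }
  destruct (kernel_vanishes G phi Cphi (eps / 2)) as [R1 H1]; [lra|].
  destruct (Hz (eps / 2 / Cmod two_pi_i)) as [R2 H2]. { apply Rdiv_lt_0_compat; lra. }
  destruct (winding_far G) as [R3 H3].
  set (z := RtoC (Rmax R1 (Rmax R2 (Rmax R3 0)) + 1)).
  assert (Hzm : Rmax R1 (Rmax R2 (Rmax R3 0)) < Cmod z).
  { unfold z. rewrite Cmod_R. eapply Rlt_le_trans; [|apply Rle_abs]. lra. }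
  assert (Hz1 := Rle_lt_trans _ _ _ (Rmax_l _ _) Hzm). assert (Hz' := Rle_lt_trans _ _ _ (Rmax_r _ _) Hzm).
  assert (Hz2 := Rle_lt_trans _ _ _ (Rmax_l _ _) Hz'). assert (Hz'' := Rle_lt_trans _ _ _ (Rmax_r _ _) Hz').
  assert (Hz3 := Rle_lt_trans _ _ _ (Rmax_l _ _) Hz'').
  destruct (H3 z Hz3) as [Hoff _].
  assert (K1 : path_continuous_on (fun t => phi t * (/ (gamma G t - z)) ^ 1)%C 0 T).
  { apply kernel_continuous; [exact Cphi|intros t _; apply curve_cont|intros t _; now apply off_curve_ne]. }
  assert (K2 : path_continuous_on (fun t => density t * (/ (gamma G t - z)) ^ 1)%C 0 T).
  { apply kernel_continuous; [apply density_continuous|intros t _; apply curve_cont|intros t _; now apply off_curve_ne]. }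
  assert (E : path_int density 0 T = (kernel_int phi (gamma G) 1 0 T z - z * cauchy_integral z)%C).
  { unfold cauchy_integral, kernel_int. rewrite <- path_int_scal, <- path_int_minus; [|auto|auto| |auto|auto].
    - apply path_int_ext; [auto|]. intros t _. assert (N := Cminus_eq_contra _ _ (off_curve_ne G z t Hoff)).
      rewrite !Cpow_1_r. unfold phi. field. auto.
    - intros t Ht. apply (ccont_mult _ (fun _ => z)); [apply ccont_const|now apply K2]. }
  rewrite E, cauchy_integral_formula by auto.
  replace (z * (two_pi_i * ((winding_number G z - kappa) * g z)))%C with (two_pi_i * (z * ((winding_number G z - kappa) * g z)))%C by ring.
  unfold Cminus at 1. eapply Rle_trans; [apply Cmod_triangle|]. rewrite Cmod_opp, Cmod_mult.
  specialize (H1 z Hz1). specialize (H2 z Hz2).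
  assert (H : Cmod two_pi_i * Cmod (z * ((winding_number G z - kappa) * g z)) <= Cmod two_pi_i * (eps / 2 / Cmod two_pi_i))
    by (apply Rmult_le_compat_l; lra).
  replace (Cmod two_pi_i * (eps / 2 / Cmod two_pi_i)) with (eps / 2) in H by (field; lra).
  unfold T. lra.
Qed.
End Dixon.

Lemma boundary_limit (D : C -> Prop) (J g : C -> C) z :
  @continuous CU CU g z -> (forall w, D w -> J w = g w) -> is_lim_within D J z (g z).
Proof.
  intros Hg HJ. apply <- continuous_CU_codomain in Hg. apply <- continuous_CU_domain in Hg.
  intros P HP. specialize (Hg P HP). unfold filtermap, within in *.
  apply (@filter_imp C (locally (T := C_UniformSpace) z) _ (fun w => P (g w))); auto.
  intros w Hw Dw. now rewrite HJ.
Qed.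

(** The filter of neighbourhoods within [D] is proper because [D] comes
    arbitrarily close to [z]; only then is the limit unique. *)
Lemma lim_within_unique (D : C -> Prop) (J : C -> C) z l :
  (forall r, 0 < r -> exists w, Cmod (w - z) < r /\ D w) ->
  is_lim_within D J z l -> lim_within D J z = l.
Proof.
  intros Had Hl. apply (@iota_unique R_AbsRing C_R_CompleteNormedModule); auto.
  intros y Hy.
  assert (FF : ProperFilter' (within D (locally (T := C_UniformSpace) z))).
  { split; [|apply within_filter, locally_filter].
    intros Hf. destruct (proj1 (locally_C z _) Hf) as [d Hd].
    destruct (Had d (cond_pos d)) as [w [Hw Dw]]. exact (Hd w Hw Dw). }
  exact (@filterlim_locally_unique C R_AbsRing C_R_NormedModule _ FF J y l Hy Hl).
Qed.

Lemma holomorphic_C_derive_n U f n : open_C U -> holomorphic U f -> holomorphic U (C_derive_n n f).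
Proof.
  intros HU Hf. induction n as [|n IH]; [exact Hf|]. exact (holomorphic_C_derive U _ HU IH).
Qed.

Lemma holomorphic_on_holomorphic U f : holomorphic_on U f -> holomorphic U f.
Proof. intros H z Hz. destruct (H z Hz) as [l Hl]. exists l. now apply is_derive_holo_deriv. Qed.

(** Common to the two halves of the theorem: [J] is the Cauchy transform,
    equal to [g] on the domain [D], and [Jn] extends it to the curve by
    limits. *)
Lemma boundary_chain G (D : C -> Prop) (J Jn g : C -> C) U :
  (forall z, on_curve G z -> forall r, 0 < r -> exists w, Cmod (w - z) < r /\ D w) ->
  holomorphic U g -> (forall z, on_curve G z -> U z) ->
  (forall w, D w -> J w = g w) ->
  (forall z, on_curve G z -> Jn z = lim_within D J z) ->
  contour_integral G g = RtoC 0 ->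
  ((forall z : C, on_curve G z -> is_lim_within D J z (Jn z)) /\
   contour_integrable G Jn /\ contour_integrable G g /\
   contour_integral G Jn = contour_integral G g /\ contour_integral G g = RtoC 0).
Proof.
  intros Had Hg HGU HJ HJn H0.
  assert (Hlim : forall z, on_curve G z -> is_lim_within D J z (g z)).
  { intros z Hz. apply boundary_limit; auto. apply (holomorphic_continuous U); auto. }
  assert (E : forall z, on_curve G z -> Jn z = g z).
  { intros z Hz. rewrite HJn by auto. apply lim_within_unique; auto. }
  assert (Hint : contour_integrable G g).
  { apply path_int_ex; [apply period_ge0|]. now apply (comp_gamma_continuous G U). }
  assert (Ei : forall t, contour_integrand G g t = contour_integrand G Jn t).
  { intros t. unfold contour_integrand. rewrite E; auto. now exists t. }
  repeat split; auto.
  - intros z Hz. rewrite E; auto.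
  - apply (@ex_RInt_ext C_R_NormedModule (contour_integrand G g)); auto.
  - unfold contour_integral. apply (path_int_ext (contour_integrand G Jn)); [apply period_ge0|]. auto.
Qed.

Lemma cauchy_transform_eq G g z :
  contour_integral G (fun t => g t / (t - z))%C = cauchy_integral G g z.
Proof.
  unfold contour_integral, cauchy_integral, kernel_int. apply (path_int_ext (contour_integrand G _)); [apply period_ge0|].
  intros t _. unfold contour_integrand, density. rewrite Cpow_1_r. unfold Cdiv. ring.
Qed.

Lemma vanishing_ext h k R : (forall z, R < Cmod z -> h z = k z) -> vanishes_at_infinity h -> vanishes_at_infinity k.
Proof.
  intros E H eps He. destruct (H eps He) as [R1 H1]. exists (Rmax R R1). intros z Hz.
  rewrite <- E. apply H1. eapply Rle_lt_trans; [apply Rmax_r|exact Hz]. eapply Rle_lt_trans; [apply Rmax_l|exact Hz].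
Qed.

Lemma vanishing_mul_z h : vanishes_at_infinity (fun z => z * h z)%C -> vanishes_at_infinity h.
Proof.
  intros H eps He. destruct (H eps He) as [R HR]. exists (Rmax R 1). intros z Hz.
  assert (Hz1 := Rle_lt_trans _ _ _ (Rmax_l _ _) Hz). assert (Hz2 := Rle_lt_trans _ _ _ (Rmax_r _ _) Hz).
  specialize (HR z Hz1). rewrite Cmod_mult in HR. assert (K := Cmod_ge_0 (h z)). nra.
Qed.

(* The limit and integrability clauses say that the boundary values and the
   contour integrals of the two displayed chains exist. *)
Theorem mainTheorem5 :
  forall (G : simple_closed_curve) (n : nat) (f F : C -> C),
    counterclockwise G ->
    generalized_cauchy_function G n f ->
    complement_function G n F ->
    ((forall z : C, on_curve G z ->
        is_lim_within (D_plus G) (Jint G n f) z (Jn G n f z)) /\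
     contour_integrable G (Jn G n f) /\
     contour_integrable G (C_derive_n n f) /\
     contour_integral G (Jn G n f) = contour_integral G (C_derive_n n f) /\
     contour_integral G (C_derive_n n f) = RtoC 0) /\
    ((forall z : C, on_curve G z ->
        is_lim_within (D_minus G) (Jint_minus G n F) z (Jn_minus G n F z)) /\
     contour_integrable G (Jn_minus G n F) /\
     contour_integrable G (C_derive_n n F) /\
     contour_integral G (Jn_minus G n F) = contour_integral G (C_derive_n n F) /\
     contour_integral G (C_derive_n n F) = RtoC 0).
Proof.
  intros G n f F ccw [U [HU [UD [UG [Hf _]]]]] [[V [HV [VD [VG [HF _]]]]] [m [Hm [M [r HM]]]]].
  assert (Hnz := two_pi_i_nz).
  destruct (winding_far G) as [R HR].
  split.
  - set (g := C_derive_n n f).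
    assert (Hg : holomorphic U g) by (apply holomorphic_C_derive_n; auto; now apply holomorphic_on_holomorphic).
    assert (Hk : forall z, ~ U z -> winding_number G z = 0).
    { intros z Hz. assert (Ho : off_curve G z) by (intros Hc; auto).
      destruct (D_cases G z Ho); [exfalso; auto|now apply winding_D_minus]. }
    assert (Hv0 : forall h : C -> C, vanishes_at_infinity (fun z => h z * ((winding_number G z - 0) * g z))%C).
    { intros h eps He. exists R. intros z Hz. rewrite (proj2 (HR z Hz)).
      replace (h z * ((0 - 0) * g z))%C with (RtoC 0) by ring. rewrite Cmod_0; lra. }
    assert (Hv : vanishes_at_infinity (fun z => (winding_number G z - 0) * g z)%C).
    { apply (vanishing_ext (fun z => 1 * ((winding_number G z - 0) * g z))%C _ 0); [intros; ring|apply (Hv0 (fun _ => RtoC 1))]. }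
    apply (boundary_chain G (D_plus G) _ _ g U); auto.
    + intros z Hz e He. now apply domains_adherent.
    + intros z Dz. unfold Jint. fold g. rewrite cauchy_transform_eq.
      rewrite (cauchy_integral_formula G U g 0) by (auto; apply Dz).
      rewrite (ccw z Dz). field. auto.
    + intros z Hz. unfold Jn. destruct (excluded_middle_informative _); tauto.
    + apply (contour_integral_zero G U g 0); auto.
  - set (g := C_derive_n n F).
    assert (HFh : holomorphic V F) by now apply holomorphic_on_holomorphic.
    assert (Hg : holomorphic V g) by now apply holomorphic_C_derive_n.
    assert (Hk : forall z, ~ V z -> winding_number G z = 1).
    { intros z Hz. assert (Ho : off_curve G z) by (intros Hc; auto).
      destruct (D_cases G z Ho); [now apply ccw|exfalso; auto]. }
    assert (Hfar : forall z, R < Cmod z -> V z).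
    { intros z Hz. destruct (HR z Hz) as [Ho Hw]. destruct (D_cases G z Ho) as [Dz|Dz]; auto.
      rewrite (ccw z Dz) in Hw. apply RtoC_inj in Hw. lra. }
    assert (Hdec : vanishes_at_infinity (fun z => z * g z)%C).
    { unfold g. clear Hg Hk. clearbody g. induction n as [|n IH].
      - intros eps He. exists (Rmax r (Rmax 1 (Rabs M / eps))). intros z Hz.
        assert (Hz1 := Rle_lt_trans _ _ _ (Rmax_l _ _) Hz). assert (Hz' := Rle_lt_trans _ _ _ (Rmax_r _ _) Hz).
        assert (Hz2 := Rle_lt_trans _ _ _ (Rmax_l _ _) Hz'). assert (Hz3 := Rle_lt_trans _ _ _ (Rmax_r _ _) Hz').
        specialize (HM z Hz1). change (C_derive_n 0 F z) with (F z). rewrite Cmod_mult.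
        set (x := Cmod z) in *.
        assert (Hx2 : x * x <= x ^ m).
        { replace (x * x) with (x ^ 2) by ring. apply Rle_pow; [lra|auto]. }
        assert (Hxx : 0 < x * x) by nra.
        apply Rle_trans with (x * (Rabs M / (x * x))).
        + apply Rmult_le_compat_l; [lra|]. eapply Rle_trans; [exact HM|].
          apply Rle_trans with (Rabs M / x ^ m).
          * apply Rmult_le_compat_r; [apply Rlt_le, Rinv_0_lt_compat; lra|apply Rle_abs].
          * apply Rmult_le_compat_l; [apply Rabs_pos|]. apply Rinv_le_contravar; lra.
        + replace (x * (Rabs M / (x * x))) with (Rabs M / x) by (field; lra).
          apply Rmult_le_reg_r with (x / eps). apply Rdiv_lt_0_compat; lra.
          replace (Rabs M / x * (x / eps)) with (Rabs M / eps) by (field; lra).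
          replace (eps * (x / eps)) with x by (field; lra). lra.
      - apply (vanishing_derive V (C_derive_n n F) R); auto. now apply holomorphic_C_derive_n. }
    assert (Hw1 : forall z, R < Cmod z -> (winding_number G z - 1 = - (1))%C).
    { intros z Hz. rewrite (proj2 (HR z Hz)). ring. }
    assert (Hdec' : vanishes_at_infinity (fun z => z * ((winding_number G z - 1) * g z))%C).
    { intros eps He. destruct (Hdec eps He) as [R1 HR1]. exists (Rmax R R1). intros z Hz.
      rewrite Hw1 by (eapply Rle_lt_trans; [apply Rmax_l|exact Hz]).
      replace (z * (- (1) * g z))%C with (- (z * g z))%C by ring. rewrite Cmod_opp.
      apply HR1. eapply Rle_lt_trans; [apply Rmax_r|exact Hz]. }
    assert (Hv := vanishing_mul_z _ Hdec').
    apply (boundary_chain G (D_minus G) _ _ g V); auto.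
    + intros z Hz e He. now apply domains_adherent.
    + intros z Dz. unfold Jint_minus. fold g. rewrite cauchy_transform_eq.
      rewrite (cauchy_integral_formula G V g 1) by (auto; apply Dz).
      rewrite (winding_D_minus G z Dz). field. auto.
    + intros z Hz. unfold Jn_minus. destruct (excluded_middle_informative _); tauto.
    + apply (contour_integral_zero G V g 1); auto.
Qed.
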